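(* Let $G$ be a graph with minimum degree $\delta\geq 3$. (1) If $\mu_2(G)>\frac{1}{\delta+1}\left(2+\frac{1}{\binom{d+1}{2}-1}\right)$, then $G$ is body-hinge rigid in $\mathbb{R}^d$ for $d\geq 2$. (2) If $\mu_2(G)>\frac{1}{\delta+1}\left(2+\frac{2}{\binom{d+1}{2}-1}\right)$, then $G$ is body-hinge globally rigid in $\mathbb{R}^d$ for $d\geq 3$.
   Context: Graphs are simple. $\mu_2(G)$ is the second smallest eigenvalue of the Laplacian $L(G)=D(G)-A(G)$. For a positive integer $t$, $tG$ is the multigraph obtained from $G$ by replacing each edge by $t$ parallel edges. A body-and-hinge framework in $\mathbb{R}^d$ consists of $d$-dimensional rigid bodies (vertices) joined by $(d-1)$-dimensional hinges (edges); $G$ is body-hinge rigid (resp. globally rigid) in $\mathbb{R}^d$ if some generic body-hinge realization is rigid (resp. globally rigid). Known characterizations: $G$ is body-hinge rigid in $\mathbb{R}^d$ iff $(\binom{d+1}{2}-1)G$ contains $\binom{d+1}{2}$ edge-disjoint spanning trees; for $d\ge 3$, $G$ is body-hinge globally rigid in $\mathbb{R}^d$ iff $(\binom{d+1}{2}-1)G-e$ contains $\binom{d+1}{2}$ edge-disjoint spanning trees for every edge $e$. *)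

(* Defs.v *)
From HB Require Import structures.
From mathcomp Require Import all_boot all_order all_algebra.
From mathcomp Require Import polyrcf reals.
(* The notations of mpoly clash with those of mathcomp-analysis. *)
From mathcomp Require Import -(notations) mpoly.

Set Implicit Arguments.
Unset Strict Implicit.
Unset Printing Implicit Defensive.

Import Order.TTheory GRing.Theory Num.Theory.
Local Open Scope ring_scope.

(* A simple graph on the finite vertex type [T] is given by a symmetric,
   irreflexive adjacency relation [e]. *)
Section Graph.
Variables (T : finType) (e : rel T).

Definition degree (v : T) : nat := #|[set w | e v w]|.

(* The neutral element #|T| exceeds every degree of a simple graph, so this is
   the true minimum as soon as [T] is inhabited. It is 0 when [T] is empty. *)
Definition min_degree : nat := \big[minn/#|T|]_(v : T) degree v.

Definition edges : {set {set T}} :=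
  [set [set p.1; p.2] | p in [set p : T * T | e p.1 p.2]].

Definition edge : finType := {f : {set T} | f \in edges}.

End Graph.

Section Spectrum.
Variable R : rcfType.

Definition adjacency (T : finType) (e : rel T) : 'M[R]_#|T| :=
  \matrix_(i, j) (e (enum_val i) (enum_val j))%:R.

Definition degree_mx (T : finType) (e : rel T) : 'M[R]_#|T| :=
  diag_mx (\row_i (degree e (enum_val i))%:R).

Definition laplacian (T : finType) (e : rel T) : 'M[R]_#|T| :=
  degree_mx e - adjacency e.

(* All real eigenvalues in increasing order, each repeated according to its
   algebraic multiplicity: [rootsR] lists the distinct real roots of a nonzero
   polynomial in increasing order. *)
Definition spectrum n (A : 'M[R]_n) : seq R :=
  flatten [seq nseq (mup x (char_poly A)) x | x <- rootsR (char_poly A)].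

Definition mu2 (T : finType) (e : rel T) : R := (spectrum (laplacian e))`_1.

End Spectrum.

Section BodyHinge.
Variables (R : realType) (d : nat) (T : finType) (e : rel T).

(* A hinge of R^d is a (d-2)-dimensional affine subspace (the axis of the
   relative rotation of two bodies); in homogeneous coordinates it is a linear
   subspace of dimension d-1. It is given here as the affine span of d-1
   points: a framework assigns such points to every edge. *)
Definition framework : Type := edge e -> 'I_d.-1 -> 'rV[R]_d.

Definition alg_independent (I : finType) (x : I -> R) : Prop :=
  forall p : mpoly #|I| rat,
    mmap ratr (fun i => x (enum_val i)) p = 0 -> p = 0.

(* The d-1 points of each hinge of a generic framework are in particular
   affinely independent, so that its hinges do have dimension d-2. *)
Definition generic (h : framework) : Prop :=
  alg_independent (fun c : edge e * 'I_d.-1 * 'I_d => h c.1.1 c.1.2 0 c.2).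

(* The pair (A, t), with A orthogonal, stands for the congruence
   x |-> x A + t of R^d. *)
Definition act (g : 'M[R]_d * 'rV[R]_d) (x : 'rV[R]_d) : 'rV[R]_d :=
  x *m g.1 + g.2.

(* An arrangement of the bodies and hinges of [h]: the body v is moved by the
   congruence g v, and the bodies that share a hinge agree on it pointwise.
   The framework itself is the arrangement in which no body is moved. *)
Definition arrangement (h : framework) (g : T -> 'M[R]_d * 'rV[R]_d) : Prop :=
  (forall v, (g v).1 *m (g v).1^T = 1%:M) /\
  (forall (f : edge e) (u v : T), u \in val f -> v \in val f ->
     forall i, act (g u) (h f i) = act (g v) (h f i)).

(* The arrangement is the image of the framework by a single congruence. *)
Definition congruent (g : T -> 'M[R]_d * 'rV[R]_d) : Prop :=
  forall u v, g u = g v.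

Definition close (eps : R) (g : T -> 'M[R]_d * 'rV[R]_d) : Prop :=
  forall v, (forall i j, `|(g v).1 i j - (1%:M : 'M[R]_d) i j| < eps) /\
            (forall j, `|(g v).2 0 j| < eps).

Definition rigid (h : framework) : Prop :=
  exists2 eps : R, 0 < eps &
    forall g, arrangement h g -> close eps g -> congruent g.

Definition globally_rigid (h : framework) : Prop :=
  forall g, arrangement h g -> congruent g.

Definition body_hinge_rigid : Prop :=
  exists h : framework, generic h /\ rigid h.

Definition body_hinge_globally_rigid : Prop :=
  exists h : framework, generic h /\ globally_rigid h.

End BodyHinge.

(* Main.v *)
Require Import Defs.
From HB Require Import structures.
(* Loaded first: [mpoly.symmetric] must not shadow [ssrbool.symmetric]. *)
From mathcomp Require Import -(notations) mpoly.
From mathcomp Require Import all_boot all_order all_algebra.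
From mathcomp Require Import spectral sesquilinear complex polyrcf.
From mathcomp Require Import ring lra zify.
From mathcomp Require Import boolp reals.
Import Order.TTheory GRing.Theory Num.Theory.
Local Open Scope ring_scope.

(* Let [g] be a noncongruent arrangement of a generic framework and call a class
   a set of vertices moved by the same congruence.

   Spectral part, from [mu2 * (delta + 1) > 2]: a vertex set with at most two
   boundary edges has more than [delta] vertices, and testing the Rayleigh
   quotient on functions that are constant on two disjoint sets shows that every
   proper nonempty set has at least two boundary edges, and that two disjoint
   sets with two boundary edges each are adjacent. Hence either three classes are
   pairwise adjacent, or the numbers [k] of classes and [m] of edges between them
   satisfy [2 m > 3 (k - 1)].

   Dimension count: the relative motion of two bodies sharing a hinge fixes that
   hinge, so it is a rational function of the coordinates of the hinge and of one
   further parameter. Along a spanning tree of the quotient graph, all congruences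
   are rational in the tree hinges and [k - 1] parameters. Each of the [m - (k - 1)]
   other hinges consists of fixed points of a nontrivial congruence, which expresses
   two of its coordinates rationally by the others. Algebraic independence thus
   forces [2 (m - (k - 1)) <= k - 1], that is, [2 m <= 3 (k - 1)].

   Triangle: if three classes are pairwise adjacent, then distances to the points
   of two hinges determine the position of the third one (for [d = 2] up to a
   reflection, which closeness to the identity excludes), so two of the three
   congruences coincide. *)

Set Implicit Arguments.
Unset Strict Implicit.
Unset Printing Implicit Defensive.

(** * Generic points *)

Section Generic.
Variable R : realType.

(** Cantor's nested intervals: the supremum of the left endpoints lies in every interval, and the
    [n]-th step discards [u n]. *)
Lemma avoid_sequence (u : nat -> R) : exists z, forall n, z != u n.
Proof.
(* The lower part kept is a quarter of the interval, not a half, so that the closed interval also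
   misses [u n] when [u n] is the midpoint. *)
pose step n (I : R * R) := let m := (I.1 + I.2) / 2 in
  if u n < m then (m, I.2) else (I.1, (I.1 + m) / 2).
pose I := fix I n := if n is n'.+1 then step n' (I n') else (0, 1).
have Ilt n : (I n).1 < (I n).2.
  elim: n => [|n IHn] /=; first by rewrite /=; lra.
  by rewrite /step; case: ifP => _ /=; lra.
have Isub n : (I n).1 <= (I n.+1).1 /\ (I n.+1).2 <= (I n).2.
  by have := Ilt n; rewrite /= /step; case: ifP => _ /=; split; lra.
have Imono m n : (m <= n)%N -> (I m).1 <= (I n).1 /\ (I n).2 <= (I m).2.
  move=> /subnK <-; elim: (n - m)%N => [|k [IH1 IH2]]; first by rewrite add0n.
  by rewrite addSn; have [J1 J2] := Isub (k + m)%N; split; lra.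
have Icross m n : (I m).1 <= (I n).2.
  have [le_mn|/ltnW le_nm] := leqP m n.
    by have := Ilt n; have := Imono _ _ le_mn; lra.
  by have := Ilt m; have := Imono _ _ le_nm; lra.
pose A : classical_sets.set R := fun x => exists n, (I n).1 = x.
have ubA n : classical_sets.ubound A (I n).2 by move=> _ [m <-].
have A0 : classical_sets.nonempty A by exists (I 0%N).1; exists 0%N.
have supA : classical_sets.has_sup A by split => //; exists (I 0%N).2; exact: ubA.
exists (sup A) => n; apply/eqP => supE.
have h1 : (I n.+1).1 <= u n.
  by rewrite -supE; apply: sup_upper_bound => //; exists n.+1.
have h2 : u n <= (I n.+1).2 by rewrite -supE; apply: sup_le_ub.
have := Ilt n; move: h1 h2; rewrite /= /step.
by case: ifPn => /=; rewrite ?ltNge ?negbK; lra.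
Qed.

Local Notation ev y := (mmap (@ratr R) y).

(** Substituting [y] into rational polynomials yields countably many polynomials in one variable, so
    some [z] avoids the roots of all nonzero ones. If [p] vanishes at [y] and [z], its coefficients
    in the last variable then vanish at [y], hence are zero. *)
Lemma extend_independent n (y : 'I_n -> R) :
  (forall p : mpoly n rat, ev y p = 0 -> p = 0) ->
  exists z, forall p : mpoly n.+1 rat,
    ev (fun i => if unlift ord_max i is Some j then y j else z) p = 0 -> p = 0.
Proof.
move=> indep_y.
pose trunc (m : multinom n.+1) : multinom n :=
  Multinom [tuple m (lift ord_max i) | i < n].
(* [Q c] substitutes [y] for the first [n] variables and keeps the last one as indeterminate. Lists
   of monomials with coefficients form a countable type, so [pickle] enumerates these
   polynomials. *)
pose Q (c : seq (multinom n.+1 * rat)) : {poly R} :=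
  \sum_(a <- c) (ratr a.2 * mmap1 y (trunc a.1)) *: 'X^(a.1 ord_max).
pose rts (k : nat) : seq R := if unpickle k is Some c then rootsR (Q c) else [::].
(* The index [k] encodes a polynomial together with the position of one of its roots; the defaults
   only add 0 to the values avoided. *)
pose u k := if unpickle k is Some (a, b) then (rts a)`_b else 0.
have [z zP] := avoid_sequence u; exists z => p p0.
pose c := [seq (m, mcoeff m p) | m <- msupp p].
have Qz : (Q c).[z] = 0.
  rewrite -[RHS]p0 /Q /c big_map horner_sum; apply: eq_bigr => m _.
  rewrite hornerZ hornerXn /= -mulrA; congr (_ * _).
  rewrite /mmap1 big_ord_recr /= unlift_none; congr (_ * _).
  apply: eq_bigr => i _.
  have -> : widen_ord (leqnSn n) i = lift ord_max i.
    by apply: val_inj; rewrite /= /bump leqNgt ltn_ord.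
  by rewrite liftK mnmE.
have Q0 : Q c = 0.
  apply: contraTeq isT => /= Qn0.
  have zr : z \in rts (pickle c).
    by rewrite /rts pickleK -(roots_on_rootsR Qn0) in_itv /=
    rootE Qz eqxx.
  have := zP (pickle (pickle c, index z (rts (pickle c)))).
  by rewrite /u pickleK nth_index // eqxx.
apply/mpolyP => m0; rewrite mcoeff0.
have [m0p|] := boolP (m0 \in msupp p); last exact: memN_msupp_eq0.
(* The coefficient in [p] of the power [m0 ord_max] of the last variable. *)
pose r : mpoly n rat := \sum_(m <- msupp p | m ord_max == m0 ord_max)
  mcoeff m p *: mpolyX _ (trunc m).
have r0 : r = 0.
  apply: indep_y; have /(congr1 (fun q : {poly R} => q`_(m0 ord_max))) := Q0.
  rewrite coef0 /Q /c big_map coef_sum raddf_sum => E; rewrite -[RHS]E /=.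
  rewrite big_mkcond; apply: eq_bigr => m _ /=.
  rewrite coefZ coefXn eq_sym; case: eqP => _; last by rewrite mulr0.
  by rewrite mulr1 mmapZ mmapX.
have := congr1 (mcoeff (trunc m0)) r0.
rewrite mcoeff0 raddf_sum /= (big_rem m0) //= eqxx mcoeffZ mcoeffX eqxx mulr1.
rewrite big_seq_cond big1 ?addr0 // => m /andP[m_in /eqP mE].
rewrite mcoeffZ mcoeffX; case: eqP => [tE|_]; last by rewrite mulr0.
have mm0 : m = m0.
  apply/mnmP => i; case: (unliftP ord_max i) => [j ->|-> //].
  by have := congr1 (fun m : multinom n => m j) tE; rewrite !mnmE.
by move: m_in; rewrite mm0 mem_rem_uniq ?msupp_uniq // !inE eqxx.
Qed.

Lemma ex_independent n : exists y : 'I_n -> R, forall p : mpoly n rat, ev y p = 0 -> p = 0.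
Proof.
elim: n => [|n [y /extend_independent[z zP]]]; last by eexists; exact: zP.
exists (fun=> 0) => p.
have -> : p = mpolyC _ (mcoeff mnm0 p).
  apply/mpolyP => m; rewrite mcoeffC.
  suff -> : m = mnm0 by rewrite eqxx mulr1.
  by apply/mnmP => -[].
by rewrite mmapC => /eqP; rewrite fmorph_eq0 => /eqP ->; rewrite mpolyC0.
Qed.

Lemma ex_alg_independent (I : finType) : exists x : I -> R, alg_independent x.
Proof.
have [y yP] := ex_independent #|I|.
exists (fun i => y (enum_rank i)) => p p0; apply: yP; rewrite -[RHS]p0.
by apply: eq_bigr => m _; congr (_ * _); apply: eq_bigr => i _; rewrite enum_valK.
Qed.

End Generic.

(** * Generated subfields and transcendence degree *)

Section FieldSpan.
Variable R : realType.
Implicit Types (s : seq R) (x y : R).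

(** The subfield generated by [s]: sums and products come from subtraction and division, and a
    division by 0 only yields 0. *)
Inductive generated s : R -> Prop :=
  | generated_mem x : x \in s -> generated s x
  | generated_one : generated s 1
  | generated_sub x y : generated s x -> generated s y -> generated s (x - y)
  | generated_div x y : generated s x -> generated s y -> generated s (x / y).

Definition field_span s : {pred R} := [pred x | `[< generated s x >]].

Lemma field_spanP s x : reflect (generated s x) (x \in field_span s).
Proof. exact: asboolP. Qed.

Lemma field_span_divring_closed s : divring_closed (field_span s).
Proof.
split=> [|x y /field_spanP x_s /field_spanP y_s|x y /field_spanP x_s /field_spanP y_s];
  apply/field_spanP.
- exact: generated_one.
- exact: generated_sub.
- exact: generated_div.
Qed.

HB.instance Definition _ s :=
  GRing.isDivringClosed.Build R (field_span s) (field_span_divring_closed s).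

Lemma mem_field_span s x : x \in s -> x \in field_span s.
Proof. by move=> x_s; apply/field_spanP/generated_mem. Qed.

Local Notation ev y := (mmap (@ratr R) y).

(** Induction with common denominators; a division by 0 is represented as 0 over 1. *)
Lemma field_span_ratio s x : x \in field_span s ->
  exists p q : mpoly (size s) rat, let y i := s`_(val i) in
    ev y q != 0 /\ x = ev y p / ev y q.
Proof.
move=> /field_spanP; elim=> {x} [x x_s||x y _ [p [q [q0 ->]]] _ [p' [q' [q'0 ->]]]
                       |x y _ [p [q [q0 ->]]] _ [p' [q' [q'0 ->]]]] /=.
- have lt_xs : (index x s < size s)%N by rewrite index_mem.
  exists (mpolyX _ (mnm1 (Ordinal lt_xs))), 1.
  by rewrite rmorph1 mmapX mmap1U /= nth_index // oner_eq0 divr1.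
- by exists 1, 1; rewrite rmorph1 oner_eq0 divr1.
- exists (p * q' - p' * q), (q * q'); rewrite rmorphB !rmorphM mulf_neq0 //.
  by split=> //; field; rewrite q0 q'0.
- have [p'0|p'0] := eqVneq (ev (fun i : 'I_(size s) => s`_i) p') 0.
    by exists 0, 1; rewrite p'0 rmorph1 rmorph0 oner_eq0 !mul0r invr0 mulr0.
  exists (p * q'), (q * p'); rewrite !rmorphM mulf_neq0 //.
  by split=> //; field; rewrite q0 p'0.
Qed.

Lemma wide_mx_ker (F : fieldType) m n (A : 'M[F]_(m, n)) : (n < m)%N ->
  exists2 v : 'rV_m, v != 0 & v *m A = 0.
Proof.
move=> lt_nm; have : kermx A != 0.
  rewrite kermx_eq0 -row_leq_rank -ltnNge.
  exact: leq_ltn_trans (rank_leq_col A) lt_nm.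
by case/rowV0Pn => v /sub_kermxP vA v0; exists v.
Qed.

Lemma card_bmultinom n b : (#|{: bmultinom n b}| <= b ^ n)%N.
Proof.
have le_mdeg (m : multinom n) i : (m i <= mdeg m)%N.
  by rewrite mdegE (bigD1 i) //= leq_addr.
pose f (m : bmultinom n b) : {ffun 'I_n -> 'I_b} :=
  [ffun i => Ordinal (leq_ltn_trans (le_mdeg (bmnm m) i) (bmdeg m))].
have f_inj : injective f.
  move=> m m' /ffunP ff; apply/val_inj/mnmP => i.
  by have := ff i; rewrite !ffunE => /(congr1 val).
by have := leq_card f f_inj; rewrite card_ffun !card_ord.
Qed.

Lemma msize_mul_le n (p q : mpoly n rat) (a b : nat) :
  (msize p <= a.+1)%N -> (msize q <= b.+1)%N -> (msize (p * q) <= (a + b).+1)%N.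
Proof.
have [->|p0] := eqVneq p 0; first by rewrite mul0r msize0.
have [->|q0] := eqVneq q 0; first by rewrite mulr0 msize0.
rewrite msizeM //; move: (msize p) (msize q) => mp mq; lia.
Qed.

Lemma msize_exp_le n (p : mpoly n rat) a k :
  (msize p <= a.+1)%N -> (msize (p ^+ k) <= (k * a).+1)%N.
Proof.
move=> pa; elim: k => [|k IHk]; first by rewrite expr0 msize1.
by rewrite exprS mulSn; exact: msize_mul_le.
Qed.

Lemma msize_prod_le n k (F : 'I_k -> mpoly n rat) a :
  (forall i, msize (F i) <= a.+1)%N -> (msize (\prod_i F i) <= (k * a).+1)%N.
Proof.
elim: k F => [|k IHk] F Fa; first by rewrite big_ord0 msize1.
by rewrite big_ord_recl mulSn; apply: msize_mul_le => //; exact: IHk.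
Qed.

(* A rational relation between the [x i] exists because the t^n monomials in
   the [x i] with exponents below t become, after clearing denominators,
   polynomials of degree O(t) in fewer than n variables. *)
Lemma ratios_dependent m n (y : 'I_m -> R) (x : 'I_n -> R)
    (p q : 'I_n -> mpoly m rat) :
    (m < n)%N -> (forall i, ev y (q i) != 0) ->
    (forall i, x i = ev y (p i) / ev y (q i)) ->
  exists2 P : mpoly n rat, P != 0 & ev x P = 0.
Proof.
move=> lt_mn q0 xE.
pose a := \max_i maxn (msize (p i)) (msize (q i)).
have pa i : (msize (p i) <= a.+1)%N.
  by apply/leqW/(leq_trans (leq_maxl _ (msize (q i))))/(leq_bigmax i).
have qa i : (msize (q i) <= a.+1)%N.
  by apply/leqW/(leq_trans (leq_maxr (msize (p i)) _))/(leq_bigmax i).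
(* [b] bounds the sizes of the cleared numerators, and [t] exceeds [(n * a.+1).+1 ^ m], so that
   [b ^ m < t ^ m.+1 <= t ^ n]. *)
pose t := ((n * a.+1).+1 ^ m).+1; pose b := (n * (t * a)).+1.
pose E := {ffun 'I_n -> 'I_t}.
(* The monomial in the [x i] with exponents [f], multiplied by the common denominator, which is the
   [t]-th power of the product of the [q i]. *)
pose S (f : E) := \prod_i (p i ^+ f i * q i ^+ (t - f i)).
have Sb f : (msize (S f) <= b)%N.
  apply: msize_prod_le => i; have ft := ltn_ord (f i).
  rewrite -[X in (X * a)%N](subnKC (ltnW ft)) mulnDl.
  by apply: msize_mul_le; exact: msize_exp_le.
pose C : 'M[rat]_(#|E|, #|{: bmultinom m b}|) :=
  \matrix_(i, j) mcoeff (bmnm (enum_val j)) (S (enum_val i)).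
have [|v v0 vC] := wide_mx_ker C.
  rewrite (leq_ltn_trans (card_bmultinom _ _)) // card_ffun !card_ord.
  have bt : (b <= t * (n * a.+1).+1)%N by rewrite /b /t; nia.
  apply: (@leq_ltn_trans (t ^ m * (n * a.+1).+1 ^ m)%N).
    by rewrite -expnMn; case: {+}m => // k; rewrite leq_exp2r.
  apply: (@leq_trans (t ^ m.+1)); last exact: leq_pexp2l.
  by rewrite expnSr ltn_pmul2l ?expn_gt0.
pose mono (f : E) : multinom n := Multinom [tuple nat_of_ord (f i) | i < n].
have mono_inj : injective mono.
  move=> f g fg; apply/ffunP => i; apply: val_inj.
  by have := congr1 (fun m : multinom n => m i) fg; rewrite !mnmE.
pose P : mpoly n rat := \sum_i v 0 i *: mpolyX _ (mono (enum_val i)).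
exists P.
  apply: contraNneq v0 => P0; apply/eqP/rowP => i.
  have := congr1 (mcoeff (mono (enum_val i))) P0.
  rewrite mcoeff0 raddf_sum (bigD1 i) //= mcoeffZ mcoeffX eqxx mulr1 mxE.
  rewrite big1 ?addr0 // => j /negPf ji.
  by rewrite mcoeffZ mcoeffX (inj_eq mono_inj) (inj_eq enum_val_inj) ji mulr0.
have SP : \sum_i v 0 i *: S (enum_val i) = 0.
  apply/mpolyP => k; rewrite mcoeff0 raddf_sum /=.
  have [kb|kb] := ltnP (mdeg k) b.
    have := congr1 (fun A : 'rV_#|{: bmultinom m b}| => A 0 (enum_rank (BMultinom kb))) vC.
    rewrite !mxE => E0; rewrite -[RHS]E0; apply: eq_bigr => i _.
    by rewrite mxE mcoeffZ enum_rankK.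
  apply: big1 => i _; rewrite mcoeffZ memN_msupp_eq0 ?mulr0 //.
  by apply: msize_mdeg_ge; apply: leq_trans (Sb _) kb.
have Q0 : ev y (\prod_i q i) ^+ t != 0.
  by rewrite expf_neq0 // rmorph_prod; apply/prodf_neq0 => i _; exact: q0.
apply: (mulIf Q0); rewrite mul0r -[RHS](rmorph0 (mmap ratr y)) -SP.
rewrite rmorph_sum raddf_sum mulr_suml; apply: eq_bigr => i _ /=.
rewrite !mmapZ -mulrA; congr (_ * _); rewrite mmapX /S.
have ratio_exp (c d : R) k l : d != 0 -> (k <= l)%N ->
    (c / d) ^+ k * d ^+ l = c ^+ k * d ^+ (l - k).
  by move=> d0 kl; rewrite -[in LHS](subnKC kl) exprD mulrA -exprMn divfK.
rewrite !rmorph_prod -prodrXl -big_split /=; apply: eq_bigr => j _.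
have ft := ltn_ord (enum_val i j).
rewrite rmorphM !rmorphXn mnmE xE /=.
by apply: ratio_exp; rewrite ?q0 // ltnW.
Qed.

(** The [x i] are ratios of polynomials in the elements of [s]; more ratios than variables would
    satisfy a polynomial relation. *)
Lemma alg_independent_card (I : finType) (x : I -> R) s :
  alg_independent x -> (forall i, x i \in field_span s) -> (#|I| <= size s)%N.
Proof.
move=> x_indep x_s; rewrite leqNgt; apply/negP => lt_s.
have /choice[pq pqP] : forall i : 'I_#|I|,
    exists pq : mpoly (size s) rat * mpoly (size s) rat,
    let y i := s`_(val i) in ev y pq.2 != 0 /\ x (enum_val i) = ev y pq.1 / ev y pq.2.
  by move=> i; have [p [q pqP]] := field_span_ratio (x_s (enum_val i)); exists (p, q).
have [P P0 /x_indep P_eq0] := ratios_dependent lt_s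
  (fun i => (pqP i).1) (fun i => (pqP i).2).
by rewrite P_eq0 eqxx in P0.
Qed.

End FieldSpan.

(** * Isometries fixing a hinge *)

Section MxOver.
Variables (F : fieldType) (K : divringClosed F).

Lemma mxOver_det n (A : 'M[F]_n) : A \is a mxOver K -> \det A \in K.
Proof.
move=> /mxOverP KA; apply: rpred_sum => s _.
by rewrite rpredM ?rpredX ?rpredN ?rpred1 // rpred_prod.
Qed.

Lemma mxOver_cofactor n (A : 'M[F]_n) i j :
  A \is a mxOver K -> cofactor A i j \in K.
Proof.
move=> /mxOverP KA; rewrite rpredM ?rpredX ?rpredN ?rpred1 //.
by apply/mxOver_det/mxOverP => k l; rewrite !mxE.
Qed.

Lemma mxOver_invmx n (A : 'M[F]_n) : A \is a mxOver K -> invmx A \is a mxOver K.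
Proof.
move=> KA; rewrite /invmx; case: ifP => // _; apply: mxOverZ.
  by rewrite rpredV mxOver_det.
by apply/mxOverP => i j; rewrite mxE mxOver_cofactor.
Qed.

Lemma mxOver_tr m n (A : 'M[F]_(m, n)) : A \is a mxOver K -> A^T \is a mxOver K.
Proof. by move=> /mxOverP KA; apply/mxOverP => i j; rewrite mxE. Qed.

Lemma mxOver_col m n (A : 'rV[F]_n) (B : 'M[F]_(m, n)) :
  A \is a mxOver K -> B \is a mxOver K ->
  (col_mx A B : 'M_(1 + m, n)) \is a mxOver K.
Proof.
by move=> /mxOverP KA /mxOverP KB; apply/mxOverP => i j; rewrite mxE; case: split.
Qed.

End MxOver.

Section Isometry.
Variable R : realType.

(** The generalized cross product of the rows of [P]. Cofactors along the first row ignore that row,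
    so 0 is a mere placeholder there. *)
Definition hyperplane_normal n (P : 'M[R]_(n, n.+1)) : 'rV[R]_n.+1 :=
  \row_j cofactor (col_mx 0 P : 'M_(1 + n)) 0 j.

Lemma mul_hyperplane_normal n (P : 'M[R]_(n, n.+1)) (w : 'rV_n.+1) :
  w *m (hyperplane_normal P)^T = (\det (col_mx w P : 'M_(1 + n)))%:M.
Proof.
apply/matrixP => i j; rewrite !ord1 !mxE eqxx mulr1n.
rewrite (expand_det_row (col_mx w P : 'M_(1 + n)) 0).
apply: eq_bigr => k _; rewrite !mxE.
have -> : (0 : 'I_(1 + n)) = lshift n 0 by apply: val_inj.
rewrite (unsplitK (inl 0)) /cofactor; congr (_ * (_ * \det _)).
apply/matrixP => a b; rewrite !mxE; case: splitP => //= c.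
by rewrite !ord1 /bump.
Qed.

Lemma hyperplane_normal_orth n (P : 'M[R]_(n, n.+1)) :
  P *m (hyperplane_normal P)^T = 0.
Proof.
apply/row_matrixP => i; rewrite row_mul mul_hyperplane_normal row0.
rewrite (@determinant_alternate _ _ (col_mx (row i P) P : 'M_(1 + n))
  (lshift n 0) (rshift 1 i)) ?raddf0 //.
by move=> j; rewrite col_mxEu col_mxEd mxE.
Qed.

Lemma row_norm_eq0 n (w : 'rV[R]_n) : ((w *m w^T) 0 0 == 0) = (w == 0).
Proof.
apply/eqP/eqP => [|->]; last by rewrite mul0mx mxE.
rewrite mxE; under eq_bigr do rewrite mxE -expr2.
move/eqP; rewrite psumr_eq0 => [/allP w0|i _]; last exact: sqr_ge0.
apply/rowP => i; rewrite mxE; apply/eqP.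
by have := w0 i (mem_index_enum _); rewrite /= sqrf_eq0.
Qed.

(** The determinant is the squared norm of the normal. *)
Lemma hyperplane_normal_unit n (P : 'M[R]_(n, n.+1)) :
  hyperplane_normal P != 0 ->
  (col_mx (hyperplane_normal P) P : 'M_(1 + n)) \in unitmx.
Proof.
move=> u0; rewrite unitmxE unitfE.
have := mul_hyperplane_normal P (hyperplane_normal P).
move=> /(congr1 (fun M : 'M_1 => M 0 0)).
by rewrite [RHS]mxE eqxx mulr1n => <-; rewrite row_norm_eq0.
Qed.

Lemma hyperplane_normal_over (K : divringClosed R) n (P : 'M[R]_(n, n.+1)) :
  P \is a mxOver K -> hyperplane_normal P \is a mxOver K.
Proof.
move=> KP; apply/mxOverP => i j; rewrite mxE.
apply: mxOver_cofactor; apply: mxOver_col => //.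
by rewrite mxOver0 ?rpred0.
Qed.

(* The normal of the fixed hyperplane is mapped to plus or minus itself. *)
Lemma orthogonal_fix_over (K : divringClosed R) n (P : 'M[R]_(n, n.+1))
    (A : 'M[R]_n.+1) :
    hyperplane_normal P != 0 -> P \is a mxOver K ->
  A *m A^T = 1%:M -> P *m A = P -> A \is a mxOver K.
Proof.
move=> u0 KP AAT PA; set u := hyperplane_normal P in u0 *.
have S_unit : (col_mx u P : 'M_(1 + n)) \in unitmx by exact: hyperplane_normal_unit.
have uP : u *m P^T = 0.
  by apply: trmx_inj; rewrite trmx_mul trmxK hyperplane_normal_orth trmx0.
have uAP : u *m A *m P^T = 0.
  by rewrite -[in P^T]PA trmx_mul -mulmxA (mulmxA A) AAT mul1mx.
pose c := (u *m A *m u^T) 0 0 / (u *m u^T) 0 0.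
have uu0 : (u *m u^T) 0 0 != 0 by rewrite row_norm_eq0.
have uA : u *m A = c *: u.
  apply/eqP; rewrite -subr_eq0; apply/eqP.
  have ST_unit : (col_mx u P : 'M_(1 + n))^T \in unitmx by rewrite unitmx_tr.
  apply: (can_inj (mulmxK ST_unit)); rewrite mul0mx tr_col_mx mul_mx_row.
  rewrite !mulmxBl uAP -!scalemxAl uP scaler0 subr0.
  rewrite [u *m A *m u^T]mx11_scalar [u *m u^T]mx11_scalar scale_scalar_mx.
  by rewrite /c divfK // subrr row_mx0.
have cc : c ^+ 2 = 1.
  have : (u *m A) *m (u *m A)^T = u *m u^T.
    by rewrite trmx_mul mulmxA -(mulmxA u) AAT mulmx1.
  rewrite uA linearZ -scalemxAl -scalemxAr scalerA -expr2.
  move/(congr1 (fun M : 'M_1 => M 0 0)); rewrite mxE -[RHS]mul1r.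
  exact: mulIf.
have Kc : c \in K.
  by move/eqP: cc; rewrite sqrf_eq1 => /orP[]/eqP ->; rewrite ?rpredN rpred1.
(* [A] is determined by the images of the basis made of [u] and the rows of [P]. *)
have -> : A = invmx (col_mx u P : 'M_(1 + n)) *m (col_mx (c *: u) P : 'M_(1 + n)).
  by rewrite -{2}PA -uA -mul_col_mx mulKmx.
have Ku := hyperplane_normal_over KP.
apply: mxOverM; first by apply: mxOver_invmx; apply: mxOver_col.
by apply: mxOver_col => //; apply: mxOverZ.
Qed.

(** The fixed points are equidistant from 0 and its image [t]. With [c] half the squared norm of
    [t], the vector [t / c] thus lies on the line of solutions [z] of [P *m z = 1]. The parameter
    [tau] is its position there, and [c] is recovered from the norm of [z]. A reflection then
    removes the translation. *)
Lemma isometry_over_one_parameter n (P : 'M[R]_(n, n.+1)) (A : 'M[R]_n.+1)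
    (t : 'rV[R]_n.+1) :
    hyperplane_normal P != 0 -> A *m A^T = 1%:M ->
    P *m A + (const_mx 1 : 'cV_n) *m t = P ->
  exists tau, forall K : divringClosed R,
    P \is a mxOver K -> tau \in K -> A \is a mxOver K /\ t \is a mxOver K.
Proof.
move=> u0 AAT PAt; set u := hyperplane_normal P in u0 *.
have [t0|t0] := eqVneq t 0.
  exists 0 => K KP _; rewrite t0 mxOver0 ?rpred0 //; split=> //.
  by apply: (orthogonal_fix_over u0 KP AAT); rewrite t0 mulmx0 addr0 in PAt.
pose c := (t *m t^T) 0 0 / 2.
have tt0 : (t *m t^T) 0 0 != 0 by rewrite row_norm_eq0.
have c0 : c != 0 by rewrite mulf_neq0 ?invr_eq0 ?pnatr_eq0.
have ttE : t *m t^T = (2 * c)%:M.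
  by rewrite [LHS]mx11_scalar /c mulrC divfK ?pnatr_eq0.
have Pt : P *m t^T = const_mx c.
  apply/matrixP => i j; rewrite ord1 !mxE.
  have rowA : row i P *m A = row i P - t.
    have /(congr1 (row i)) := PAt; rewrite raddfD /= !row_mul => {2}<-.
    suff -> : row i (const_mx 1) = 1%:M :> 'M[R]_1 by rewrite mul1mx addrK.
    by apply/matrixP => a b; rewrite !ord1 !mxE eqxx.
  have : (row i P *m A) *m (row i P *m A)^T = row i P *m (row i P)^T.
    by rewrite trmx_mul mulmxA -(mulmxA (row i P)) AAT mulmx1.
  rewrite rowA linearB /= mulmxBl !mulmxBr ttE.
  have -> : t *m (row i P)^T = (row i P *m t^T)^T by rewrite trmx_mul trmxK.
  move/(congr1 (fun M : 'M_1 => M 0 0)).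
  have -> : \sum_j P i j * t^T j 0 = (row i P *m t^T) 0 0.
    by rewrite [RHS]mxE; apply: eq_bigr => k _; rewrite !mxE.
  have subE (M N : 'M[R]_1) : (M - N) 0 0 = M 0 0 - N 0 0 by rewrite !mxE.
  rewrite !subE [X in _ - (X - _)]mxE [X in _ - (_ - X)]mxE eqxx mulr1n; lra.
pose S : 'M_(1 + n) := col_mx u P.
have S_unit : S \in unitmx by exact: hyperplane_normal_unit.
(* [v1] is the solution of [P *m z = 1] orthogonal to [u], and [v2] spans the solutions of
   [P *m z = 0]. *)
pose v1 : 'cV_n.+1 := invmx S *m col_mx (0 : 'cV_1) (const_mx 1).
pose v2 : 'cV_n.+1 := invmx S *m col_mx (1%:M : 'cV_1) 0.
pose r := (u *m t^T) 0 0.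
pose tau := r / c.
pose z := v1 + tau *: v2.
have tE : t^T = c *: z.
  rewrite -(mulKmx S_unit t^T) mul_col_mx Pt /z /v1 /v2 -linearZ /= -mulmxDr -linearZ /=.
  congr (_ *m _); rewrite scale_col_mx add_col_mx scale_col_mx.
  rewrite scaler0 add0r addr0 scalerA mulrC divfK //.
  rewrite [u *m _]mx11_scalar scale_scalar_mx mulr1 -/r; congr col_mx.
  by apply/matrixP => i j; rewrite !mxE mulr1.
(* The squared norm of [t] is both [2 * c] and [c ^+ 2] times that of [z]. *)
have zz : c * (z^T *m z) 0 0 = 2.
  apply: (mulfI c0); rewrite [RHS]mulrC.
  have := congr1 (fun M : 'M_1 => M 0 0) ttE.
  have -> : t = c *: z^T by rewrite -[t]trmxK tE linearZ.
  rewrite linearZ /= trmxK -scalemxAl -scalemxAr scalerA !mxE eqxx mulr1n => <-.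
  by rewrite mulrA.
exists tau => K KP Ktau.
have KS : invmx S \is a mxOver K.
  by apply: mxOver_invmx; apply: mxOver_col => //; apply: hyperplane_normal_over.
have Kv1 : v1 \is a mxOver K.
  by apply: mxOverM => //; apply: mxOver_col; rewrite ?mxOver0 ?mxOver_const ?rpred0 ?rpred1.
have Kv2 : v2 \is a mxOver K.
  by apply: mxOverM => //; apply: mxOver_col; rewrite ?mxOver0 ?mxOver_scalar ?rpred0 ?rpred1.
have Kz : z \is a mxOver K by rewrite rpredD // mxOverZ.
have Kzz : (z^T *m z) 0 0 \in K.
  by move/mxOverP: (mxOverM (mxOver_tr Kz) Kz); apply.
have Kc : c \in K.
  suff -> : c = 2 / (z^T *m z) 0 0 by rewrite rpred_div ?rpred_nat.
  have zz0 : (z^T *m z) 0 0 != 0.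
    by apply: contra_eq_neq zz => ->; rewrite mulr0 eq_sym pnatr_eq0.
  by rewrite -zz mulfK.
have Kt : t \is a mxOver K.
  by rewrite -[t]trmxK mxOver_tr // tE mxOverZ.
split=> //.
(* The reflection exchanging the origin and [t] fixes the points of [P]. *)
pose H : 'M_n.+1 := 1%:M - c^-1 *: (t^T *m t).
have KH : H \is a mxOver K.
  rewrite rpredB ?mxOver_scalar ?rpred0 ?rpred1 //.
  by apply: mxOverZ; rewrite ?rpredV //; apply: mxOverM => //; apply: mxOver_tr.
have HT : H^T = H by rewrite linearB linearZ /= trmx_mul trmxK tr_scalar_mx.
have HH : H *m H = 1%:M.
  rewrite mulmxBl mulmxBr !mul1mx mulmxBr mulmx1.
  rewrite -scalemxAl -scalemxAr -mulmxA (mulmxA t) ttE mul_scalar_mx -scalemxAr !scalerA.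
  rewrite (_ : c^-1 * (c^-1 * (2 * c)) = 2 * c^-1); last by field.
  move: (t^T *m t) => M; apply/matrixP => i j; rewrite !mxE; ring.
rewrite -(mulmx1 A) -HH mulmxA; apply: mxOverM => //.
apply: (orthogonal_fix_over u0 KP).
  by rewrite trmx_mul HT mulmxA -(mulmxA A) HH mulmx1.
rewrite mulmxA (_ : P *m A = P - const_mx 1 *m t); last by rewrite -{2}PAt addrK.
have PtT : P *m (t^T *m t) = c *: (const_mx 1 *m t).
  rewrite mulmxA Pt scalemxAl; congr (_ *m _).
  by apply/matrixP => i j; rewrite !mxE mulr1.
have tT : const_mx 1 *m t *m (t^T *m t) = (2 * c) *: (const_mx 1 *m t) :> 'M_(n, n.+1).
  by rewrite mulmxA -(mulmxA _ t) ttE mul_mx_scalar scalemxAl.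
rewrite mulmxBr mulmx1 -scalemxAr mulmxBl PtT tT.
move: (const_mx 1 *m t) => M; apply/matrixP => i j; rewrite !mxE; field.
exact: c0.
Qed.

End Isometry.

(** * Nonvanishing determinants at generic points *)

Section GenericDeterminant.
Variables (R : realType) (I : finType) (x : I -> R).
Hypothesis x_indep : alg_independent x.

(* The determinant is a polynomial in the coordinates. It does not vanish
   identically because it is 1 at the point where [x (a i i) = 1] for all [i]
   and all other coordinates are 0. *)
Lemma generic_det_neq0 m (a : 'I_m -> 'I_m -> I) (b : 'I_m -> option I) :
    (forall i j k l, a i j = a k l -> (i, j) = (k, l)) ->
    (forall i j, b j <> Some (a i i)) ->
  \det (\matrix_(i, j) (x (a i j) - oapp x 0 (b j))) != 0.
Proof.
move=> a_inj b_a; pose X (c : I) : mpoly #|I| rat := mpolyX _ (mnm1 (enum_rank c)).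
pose M : 'M[mpoly #|I| rat]_m := \matrix_(i, j) (X (a i j) - oapp X 0 (b j)).
pose ev : {rmorphism mpoly #|I| rat -> R} := mmap (@ratr R) (fun i => x (enum_val i)).
have evX c : ev (X c) = x c by rewrite [LHS]mmapX mmap1U enum_rankK.
have <- : map_mx ev M = \matrix_(i, j) (x (a i j) - oapp x 0 (b j)).
  apply/matrixP => i j; rewrite !mxE rmorphB; congr (_ - _); first exact: evX.
  by case: (b j) => [c|] /=; rewrite ?rmorph0 //; exact: evX.
rewrite det_map_mx; apply/eqP => /x_indep detM.
pose v (c : I) : rat := [exists i, c == a i i]%:R.
have : mmap idfun (fun i : 'I_#|I| => v (enum_val i)) (\det M) = 1.
  rewrite -det_map_mx -[RHS](det1 _ m); congr (\det _); apply/matrixP => i j.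
  rewrite !mxE rmorphB /= mmapX mmap1U enum_rankK.
  have -> : mmap idfun (fun i : 'I_#|I| => v (enum_val i)) (oapp X 0 (b j)) = 0.
    have := b_a ^~ j; case: (b j) => [c|] bj /=; rewrite ?rmorph0 //.
    rewrite mmapX mmap1U enum_rankK /v; case: existsP => // -[k /eqP cE].
    by case: (bj k); rewrite cE.
  rewrite subr0 /v; congr (_%:R); congr nat_of_bool.
  apply/existsP/eqP => [[k /eqP /a_inj[-> ->]] //|->].
  by exists j.
by rewrite detM rmorph0 => /eqP; rewrite eq_sym oner_eq0.
Qed.

End GenericDeterminant.

(** * Relative motions and their fixed points *)

Section Motion.
Variable R : realType.

(** For orthogonal [g1.1] this is [g2] followed by the inverse of [g1]: the motion of the second
    body as seen from the first. *)
Definition relative d (g1 g2 : 'M[R]_d * 'rV[R]_d) : 'M[R]_d * 'rV[R]_d :=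
  (g2.1 *m g1.1^T, (g2.2 - g1.2) *m g1.1^T).

Variable d : nat.
Implicit Types g : 'M[R]_d * 'rV[R]_d.

Lemma orthogonal_tr (A : 'M[R]_d) : A *m A^T = 1%:M -> A^T *m A = 1%:M.
Proof. exact: mulmx1C. Qed.

Lemma relative_orthogonal g1 g2 : g1.1 *m g1.1^T = 1%:M -> g2.1 *m g2.1^T = 1%:M ->
  (relative g1 g2).1 *m (relative g1 g2).1^T = 1%:M.
Proof.
move=> o1 o2 /=; rewrite trmx_mul trmxK mulmxA -(mulmxA g2.1).
by rewrite (orthogonal_tr o1) mulmx1.
Qed.

Lemma act_relative g1 g2 p q : g1.1 *m g1.1^T = 1%:M ->
  act g2 p = act g1 q -> act (relative g1 g2) p = q.
Proof.
move=> o1; rewrite /act /= => E.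
rewrite mulmxA -mulmxDl addrA E addrK -mulmxA o1 mulmx1 //.
Qed.

Lemma relative_mulr g1 g2 : g1.1 *m g1.1^T = 1%:M ->
  g2 = ((relative g1 g2).1 *m g1.1, (relative g1 g2).2 *m g1.1 + g1.2).
Proof.
move=> o1; rewrite /= -!mulmxA (orthogonal_tr o1) !mulmx1 subrK.
by case: g2.
Qed.

Lemma relative_id g1 : g1.1 *m g1.1^T = 1%:M -> relative g1 g1 = (1%:M, 0).
Proof. by move=> o1; rewrite /relative o1 subrr mul0mx. Qed.

Lemma relative_inj g1 : g1.1 *m g1.1^T = 1%:M -> injective (relative g1).
Proof.
by move=> o1 g2 g3 E; rewrite [g2](relative_mulr _ o1) [g3](relative_mulr _ o1) E.
Qed.

(** The relative motion is a translation that fixes [p]. *)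
Lemma relative_eq1 g1 g2 p : g1.1 *m g1.1^T = 1%:M -> act g1 p = act g2 p ->
  (relative g1 g2).1 = 1%:M -> g1 = g2.
Proof.
move=> o1 E A1; apply/esym/(relative_inj o1); rewrite relative_id //.
have := act_relative o1 (esym E); rewrite /act A1 mulmx1.
move=> /(congr1 (fun q => q - p)); rewrite addrC addKr subrr => t0.
by rewrite [LHS]surjective_pairing A1 t0.
Qed.

(* A nontrivial affine map fixes at most a hyperplane. *)
Lemma fixed_coordinate (A : 'M[R]_d) (t : 'rV[R]_d) : A != 1%:M ->
  exists j0, forall (K : divringClosed R) p,
    A \is a mxOver K -> t \is a mxOver K -> p *m A + t = p ->
    (forall j, j != j0 -> p 0 j \in K) -> p 0 j0 \in K.
Proof.
move=> A1; have /matrix0Pn[j0 [k Mk]] : A - 1%:M != 0 by rewrite subr_eq0.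
exists j0 => K p KA Kt fixp Kp.
have /matrixP/(_ 0 k) : p *m (A - 1%:M) = - t.
  by rewrite mulmxBr mulmx1 -{2}fixp opprD addNKr.
rewrite !mxE (bigD1 j0) //= => E.
have KM j l : (A - 1%:M) j l \in K.
  by rewrite !mxE rpredB ?(mxOverP KA) // rpred_nat.
have -> : p 0 j0 = (- t 0 k - \sum_(i | i != j0) p 0 i * (A - 1%:M) i k) / (A - 1%:M) j0 k.
  by apply: (canRL (mulfK Mk)); rewrite -E addrK.
rewrite rpred_div ?rpredB ?rpredN ?(mxOverP Kt) // rpred_sum // => i ij.
by rewrite rpredM ?Kp.
Qed.

Lemma fixed_point_unique_over (A : 'M[R]_d) (t p : 'rV[R]_d) (K : divringClosed R) :
  A - 1%:M \in unitmx -> A \is a mxOver K -> t \is a mxOver K ->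
  p *m A + t = p -> p \is a mxOver K.
Proof.
move=> A1 KA Kt fixp.
have <- : - t *m invmx (A - 1%:M) = p.
  apply: (canLR (mulmxK A1)).
  by rewrite mulmxBr mulmx1 -{2}fixp opprD addNKr.
apply: mxOverM; first by rewrite rpredN.
apply: mxOver_invmx; apply: rpredB => //.
by rewrite mxOver_scalar ?rpred0 ?rpred1.
Qed.

End Motion.

(** * The dimension count *)

Lemma det_mx2 (K : comPzRingType) (A : 'M[K]_2) :
  \det A = A 0 0 * A 1 1 - A 0 1 * A 1 0.
Proof.
rewrite (expand_det_row A 0) !big_ord_recl big_ord0 addr0 /cofactor !det_mx11 !mxE /=.
rewrite expr0 mul1r expr1 mulN1r mulrN.
by congr (_ * A _ _ - A _ _ * A _ _); apply: val_inj.
Qed.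

(** A nontrivial plane rotation has no eigenvalue 1. With rows [a, b] and [c, k], the sum of squares
    of the entries minus twice the determinant is [(a - k) ^+ 2 + (b + c) ^+ 2], hence this is 0;
    then the determinant of [A - 1] is [2 - 2 * a], which vanishes only if [a = 1]. *)
Lemma plane_rotation_sub1_unit (F : realFieldType) (A : 'M[F]_2) :
  A *m A^T = 1%:M -> \det A = 1 -> A != 1%:M -> A - 1%:M \in unitmx.
Proof.
move=> AAT detA A1; rewrite unitmxE unitfE; apply: contra A1 => /eqP.
have E i j : A i 0 * A j 0 + A i 1 * A j 1 = (i == j)%:R.
  have /matrixP/(_ i j) := AAT; rewrite !mxE big_ord_recr big_ord1 /= !mxE => <-.
  by congr (A _ _ * A _ _ + A _ _ * A _ _); apply: val_inj.
have := E 0 0; have := E 0 1; have := E 1 1; move: detA.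
rewrite !det_mx2 !mxE /= !mulr0n !subr0.
set a := A 0 0; set b := A 0 1; set c := A 1 0; set k := A 1 1.
move=> E1 E2 E3 E4 E5.
have ak2 : (a - k) ^+ 2 + (b + c) ^+ 2 = 0 by lra.
have [ak bc] : a = k /\ b = - c.
  move/eqP: ak2; rewrite paddr_eq0 ?sqr_ge0 // !sqrf_eq0 => /andP[/eqP ? /eqP ?].
  by split; lra.
have a1 : a = 1 by lra.
have b0 : b = 0 by apply/eqP; rewrite -sqrf_eq0; apply/eqP; rewrite a1 in E4; lra.
apply/eqP/matrixP => i j; rewrite mxE; case: i => -[|[|//]] ?; case: j => -[|[|//]] ?.
- by rewrite -[RHS]a1; congr (A _ _); apply: val_inj.
- by rewrite -[RHS]b0; congr (A _ _); apply: val_inj.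
- rewrite [RHS](_ : _ = c); last by rewrite /=; lra.
  by congr (A _ _); apply: val_inj.
- rewrite [RHS](_ : _ = k); last by rewrite -ak a1.
  by congr (A _ _); apply: val_inj.
Qed.

Section DimensionCount.
Variables (R : realType) (T : finType) (e : rel T) (n : nat).
Variable h : framework R n.+1 e.
Hypothesis h_gen : generic h.

Definition hinge (f : edge e) : 'M[R]_(n, n.+1) := \matrix_(i, j) h f i 0 j.

(** The first cofactor is the determinant of the last [n] coordinates of the [n] hinge points,
    nonzero by genericity. *)
Lemma hinge_normal_neq0 f : hyperplane_normal (hinge f) != 0.
Proof.
pose a i j : edge e * 'I_n * 'I_n.+1 := (f, i, lift 0 j).
apply/negP => /eqP/rowP/(_ 0); rewrite !mxE /cofactor addn0 expr0 mul1r.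
apply/eqP; have := generic_det_neq0 h_gen (a := a) (b := fun=> None).
rewrite (_ : \matrix_(i, j) _ = row' 0 (col' 0 (col_mx 0 (hinge f) : 'M_(1 + n)))).
  apply=> // i j k l E; have := congr1 snd E; have := congr1 (fun q => q.1.2) E.
  by move=> /= -> /lift_inj ->.
apply/matrixP => i j; rewrite !mxE subr0; case: splitP => [k|k /= /eqP].
  by rewrite ord1.
by rewrite /bump eqSS => /eqP/val_inj ->; rewrite mxE.
Qed.

Variable g : T -> 'M[R]_n.+1 * 'rV[R]_n.+1.
Hypothesis g_arr : arrangement h g.

Lemma relative_fix_hinge (f : edge e) u v i : u \in val f -> v \in val f ->
  act (relative (g u) (g v)) (h f i) = h f i.
Proof. by move=> uf vf; apply: act_relative (g_arr.1 u) (g_arr.2 f v u vf uf i). Qed.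

(** The motion of [v] relative to [u] fixes the hinge, so passing from [u] to [v] costs one
    parameter. *)
Lemma across_hinge_over (f : edge e) u v : u \in val f -> v \in val f ->
  exists tau, forall K : divringClosed R,
    hinge f \is a mxOver K -> tau \in K ->
    (g u).1 \is a mxOver K -> (g u).2 \is a mxOver K ->
    (g v).1 \is a mxOver K /\ (g v).2 \is a mxOver K.
Proof.
move=> uf vf; have ou := g_arr.1 u; have ov := g_arr.1 v.
have [tau tauP] : exists tau, forall K : divringClosed R,
    hinge f \is a mxOver K -> tau \in K ->
    (relative (g u) (g v)).1 \is a mxOver K /\ (relative (g u) (g v)).2 \is a mxOver K.
  apply: isometry_over_one_parameter (hinge_normal_neq0 f) _ _.
    exact: relative_orthogonal.
  apply/row_matrixP => i; rewrite raddfD /= !row_mul.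
  have -> : row i (hinge f) = h f i by apply/rowP => j; rewrite !mxE.
  have -> : row i (const_mx 1 : 'cV[R]_n) = 1%:M.
    by apply/matrixP => a b; rewrite !ord1 !mxE eqxx.
  by rewrite mul1mx; exact: (relative_fix_hinge i uf vf).
exists tau => K Kf Ktau Ku1 Ku2; have [Kr1 Kr2] := tauP K Kf Ktau.
rewrite [g v](relative_mulr (g v) ou); split; first exact: mxOverM.
by apply: rpredD => //; exact: mxOverM.
Qed.

Hypothesis n_gt0 : (0 < n)%N.
Hypothesis g_det : n = 1%N -> forall u v, \det ((g v).1 *m (g u).1^T) = 1.

(** The hinge is fixed by a relative motion with nontrivial linear part. For [n = 1] the hinge is
    one point, the only fixed point of a rotation, so both coordinates follow from the motion. For
    [n > 1] the same coordinate is solved for in each of two hinge points. *)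
Lemma two_dependent_coordinates (f : edge e) u v :
    u \in val f -> v \in val f -> g u <> g v ->
  exists2 a : bool -> 'I_n * 'I_n.+1, a true != a false &
    forall K : divringClosed R,
    (forall w, (w == u) || (w == v) -> (g w).1 \is a mxOver K /\ (g w).2 \is a mxOver K) ->
    (forall i j, (forall b, a b <> (i, j)) -> h f i 0 j \in K) ->
    forall i j, h f i 0 j \in K.
Proof.
move=> uf vf guv; have ou := g_arr.1 u; have ov := g_arr.1 v.
have A1 : (relative (g u) (g v)).1 != 1%:M.
  apply/eqP => A1; apply: guv.
  exact: (relative_eq1 ou (g_arr.2 f u v uf vf (Ordinal n_gt0)) A1).
have rel_over (K : divringClosed R) :
    (forall w, (w == u) || (w == v) -> (g w).1 \is a mxOver K /\ (g w).2 \is a mxOver K) ->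
    (relative (g u) (g v)).1 \is a mxOver K /\ (relative (g u) (g v)).2 \is a mxOver K.
  move=> Kg; have [Ku1 Ku2] := Kg u (introT orP (or_introl (eqxx u))).
  have [Kv1 Kv2] := Kg v (introT orP (or_intror (eqxx v))).
  have KuT := mxOver_tr Ku1.
  by split; apply: mxOverM => //; apply: rpredB.
have [n1|n_neq1] := eqVneq n 1%N.
  pose i0 := Ordinal n_gt0.
  have one_lt : (1 < n.+1)%N by rewrite n1.
  exists (fun b : bool => (i0, if b then 0 else Ordinal one_lt)) => // K Kg Kh i j.
  have [K1 K2] := rel_over K Kg.
  suff /mxOverP : h f i \is a mxOver K by apply.
  apply: fixed_point_unique_over K1 K2 (relative_fix_hinge i uf vf).
  have oR := relative_orthogonal ou ov.
  have dR : \det (relative (g u) (g v)).1 = 1 := g_det n1 u v.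
  move: A1 oR dR; move: (relative (g u) (g v)).1; rewrite n1 => A A1 oA dA.
  exact: plane_rotation_sub1_unit.
have n_gt1 : (1 < n)%N by rewrite ltn_neqAle eq_sym n_neq1.
have [j0 j0P] := fixed_coordinate (relative (g u) (g v)).2 A1.
pose i0 := Ordinal n_gt0; pose i1 := Ordinal n_gt1.
exists (fun b : bool => (if b then i0 else i1, j0)) => // K Kg Kh.
have [K1 K2] := rel_over K Kg.
have Kj i j : j != j0 -> h f i 0 j \in K.
  by move=> /eqP jj0; apply: Kh => b [_ /esym].
move=> i j; have [->|] := eqVneq j j0; last exact: Kj.
by apply: j0P K1 K2 (relative_fix_hinge i uf vf) _ => l; exact: Kj.
Qed.

Variables (C : finType) (c : T -> C).
Hypothesis c_g : forall u v, c u = c v <-> g u = g v.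

Definition crossing : {set edge e} :=
  [set f : edge e | [exists u in val f, exists v in val f, c u != c v]].

Hypothesis e_conn : forall X : {set T}, X != set0 -> X != setT ->
  exists u v, [/\ u \in X, v \notin X & e u v].

Variable r : T.
Hypothesis g_r : g r = (1%:M, 0).

(** A tree in the quotient graph is grown from the class of [r], which is at rest: [D] holds the
    classes reached, [F] the hinges crossed and [taus] their parameters. Connectedness supplies the
    next edge. *)
Lemma tree_over k : (k < #|c @: T|)%N ->
  exists (D : {set C}) (F : {set edge e}) (taus : seq R),
    [/\ D \subset c @: T, #|D| = k.+1, (#|F| <= k)%N, (size taus <= k)%N &
     forall K : divringClosed R,
       {in F, forall f, hinge f \is a mxOver K} -> {subset taus <= K} ->
       forall w, c w \in D -> (g w).1 \is a mxOver K /\ (g w).2 \is a mxOver K].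
Proof.
elim: k => [|k IHk] lt_k.
  exists [set c r], set0, [::]; split; rewrite ?cards0 ?cards1 //.
    by rewrite sub1set imset_f.
  move=> K _ _ w; rewrite inE => /eqP/c_g ->; rewrite g_r.
  by rewrite mxOver0 ?mxOver_scalar ?rpred0 ?rpred1.
have [D [F [taus [Dc cardD cardF cardt DP]]]] := IHk (ltnW lt_k).
have [||u [v [uX vX euv]]] := e_conn (X := c @^-1: D).
- have /card_gt0P[x xD] : (0 < #|D|)%N by rewrite cardD.
  have /imsetP[w _ xw] := subsetP Dc x xD.
  by apply/set0Pn; exists w; rewrite inE -xw.
- apply: contraTneq lt_k => XT; rewrite -leqNgt -cardD subset_leq_card //.
  by apply/subsetP => _ /imsetP[w _ ->]; have := in_setT w; rewrite -XT inE.
rewrite !inE in uX vX.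
have f_edge : [set u; v] \in edges e by apply/imsetP; exists (u, v); rewrite ?inE.
pose f : edge e := exist (fun E : {set T} => E \in edges e) _ f_edge.
have [||tau tauP] := @across_hinge_over f u v; rewrite ?inE ?eqxx ?orbT //.
exists (c v |: D), (f |: F), (tau :: taus); split.
- by rewrite subUset sub1set imset_f.
- by rewrite cardsU1 vX cardD.
- by rewrite cardsU1; case: (f \notin F); rewrite ?add1n ?add0n // ltnW.
- by [].
move=> K KF Kt w; rewrite !inE => /predU1P[/c_g ->|].
  have [||Ku1 Ku2] := DP K _ _ u uX.
  - by move=> f' f'F; apply: KF; rewrite inE f'F orbT.
  - by move=> x xt; apply: Kt; rewrite inE xt orbT.
  by apply: tauP => //; [apply: KF; rewrite setU11|apply: Kt; rewrite mem_head].
apply: DP => [f' f'F|x xt]; first by apply: KF; rewrite inE f'F orbT.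
by apply: Kt; rewrite inE xt orbT.
Qed.

(* Were there more hinges, the coordinates of [h] would lie in a field generated
   by fewer elements: a spanning tree of the quotient needs one parameter per
   hinge, and each further hinge saves two coordinates. *)
Lemma crossing_bound : (2 * #|crossing| <= 3 * #|c @: T|.-1)%N.
Proof.
set k := #|c @: T|.-1.
have k_lt : (k < #|c @: T|)%N.
  by rewrite /k ltn_predL; apply/card_gt0P; exists (c r); rewrite imset_f.
have [D [F [taus [Dc cardD cardF cardt DP]]]] := tree_over k_lt.
have D_all w : c w \in D.
  suff -> : D = c @: T by rewrite imset_f.
  by apply/eqP; rewrite eqEcard Dc cardD leqSpred.
pose NT := crossing :\: F.
have NTP (f : edge e) : exists a : bool -> 'I_n * 'I_n.+1, f \in NT ->
    a true != a false /\ forall K : divringClosed R,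
    (forall w, (g w).1 \is a mxOver K /\ (g w).2 \is a mxOver K) ->
    (forall i j, (forall b, a b <> (i, j)) -> h f i 0 j \in K) ->
    forall i j, h f i 0 j \in K.
  have [|_] := boolP (f \in NT); last by exists (fun=> (Ordinal n_gt0, 0)).
  rewrite !inE => /andP[_ /exists_inP[u uf /exists_inP[v vf cuv]]].
  have guv : g u <> g v by move/c_g/eqP; rewrite (negPf cuv).
  have [a a_neq aP] := two_dependent_coordinates uf vf guv.
  by exists a => _; split=> // K Kg; apply: aP.
have {NTP} /choice[a aP] := NTP.
pose I : finType := (edge e * 'I_n * 'I_n.+1)%type.
(* The omitted coordinates: two for each crossing hinge outside the tree. *)
pose drop (fb : edge e * bool) : I := (fb.1, (a fb.1 fb.2).1, (a fb.1 fb.2).2).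
pose Dr := drop @: setX NT [set: bool].
have cardDr : #|Dr| = (2 * #|NT|)%N.
  rewrite card_in_imset ?cardsX ?cardsT ?card_bool 1?mulnC //.
  move=> [f b] [f' b'] /setXP[fNT _] _ [<- E1 E2]; congr (_, _).
  have {E1 E2} : a f b = a f b' by case: (a f b) (a f b') E1 E2 => ? ? [? ?] /= -> ->.
  by have [/eqP a_neq _] := aP f fNT; case: b b' => -[] // /esym.
pose x (i : I) := h i.1.1 i.1.2 0 i.2.
pose s := [seq x i | i <- enum (~: Dr)] ++ taus.
have s_x i : i \notin Dr -> x i \in field_span s.
  move=> iDr; apply: mem_field_span; rewrite mem_cat map_f //.
  by rewrite mem_enum inE.
have s_g w : (g w).1 \is a mxOver (field_span s) /\ (g w).2 \is a mxOver (field_span s).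
  apply: DP => [f fF|t tt|//]; last by apply: mem_field_span; rewrite mem_cat tt orbT.
  apply/mxOverP => i j; rewrite mxE; apply: (s_x (f, i, j)).
  by apply/imsetP => -[[f' b] /setXP[]]; rewrite !inE => /andP[/negPf f'F _] _ [ff' _ _];
    rewrite -ff' fF in f'F.
have s_all i : x i \in field_span s.
  have [/imsetP[[f b] /setXP[fNT _] ->]|] := boolP (i \in Dr); last exact: s_x.
  have [_ fP] := aP f fNT; apply: fP => // i' j' ab.
  apply: (s_x (f, i', j')); apply/imsetP => -[[f' b'] _ [<- E1 E2]].
  by apply: (ab b'); rewrite E1 E2 -surjective_pairing.
have := alg_independent_card h_gen s_all.
(* Cancelling the coordinates kept leaves [2 * #|NT| <= size taus <= k], while
   [#|crossing| <= k + #|NT|]. *)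
rewrite size_cat size_map -cardE -(cardsC Dr) addnC leq_add2l cardDr => cardNT.
have := cardsID F crossing; rewrite -/NT => cardC.
have cardI : (#|crossing :&: F| <= #|F|)%N by rewrite subset_leq_card ?subsetIr.
lia.
Qed.

End DimensionCount.

(** * Spectral and combinatorial bounds *)

Section Spectrum.
Variable R : rcfType.

Lemma sorted_rootsR (p : {poly R}) : sorted <%R (rootsR p).
Proof. exact: sorted_roots. Qed.

Lemma mup_prod_XsubC (s : seq R) x : mup x (\prod_(a <- s) ('X - a%:P)) = count_mem x s.
Proof.
elim: s => [|a s IHs]; first by rewrite big_nil mupNroot // root1.
rewrite big_cons mupM ?polyXsubC_eq0 ?(monic_neq0 (monic_prod_XsubC _ _ _)) //.
rewrite IHs /=; congr (_ + _)%N.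
by have := mup_XsubCX 1 x a; rewrite expr1 => ->; case: eqP.
Qed.

Lemma spectrum_sorted n (A : 'M[R]_n) : sorted <=%R (spectrum A).
Proof.
rewrite /spectrum; elim: (rootsR _) (sorted_rootsR (char_poly A)) => //= x s IHs.
rewrite (path_sortedE lt_trans) => /andP[x_s /IHs s_sorted].
elim: (mup x _) => [|k IHk] //=.
rewrite path_min_sorted //; apply/allP => y.
rewrite mem_cat mem_nseq => /orP[/andP[_ /eqP -> //]|].
move=> /flatten_mapP[z z_s]; rewrite mem_nseq => /andP[_ /eqP ->].
exact/ltW/(allP x_s).
Qed.

Lemma spectrum_split n (A : 'M[R]_n) (s : seq R) :
  char_poly A = \prod_(a <- s) ('X - a%:P) -> perm_eq (spectrum A) s.
Proof.
move=> charA; apply/allP => x _ /=; apply/eqP.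
rewrite -[RHS]mup_prod_XsubC -charA /spectrum.
have p0 : char_poly A != 0 by rewrite monic_neq0 ?char_poly_monic.
have [x_root|x_root] := boolP (x \in rootsR (char_poly A)); last first.
  rewrite mupNroot; last first.
    by apply: contra x_root => px; rewrite -(roots_on_rootsR p0) in_itv.
  apply/count_memPn; apply: contra x_root => /flatten_mapP[z z_s].
  by rewrite mem_nseq => /andP[_ /eqP ->].
rewrite count_flatten -map_comp sumnE big_map.
have uniq_roots : uniq (rootsR (char_poly A)).
  exact: (sorted_uniq lt_trans ltxx (sorted_rootsR _)).
rewrite (bigD1_seq x) //= count_nseq /= eqxx mul1n big1 ?addn0 // => y yx.
by rewrite count_nseq /= (negPf yx).
Qed.

(** In an orthonormal eigenbasis at most one eigenvalue is below [c], namely the 0 belonging to [v].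
    Hence [v] is supported on a single coordinate, and there [f] vanishes. *)
Lemma second_eigenvalue_le n (A : 'M[R]_n) (v f : 'rV[R]_n) :
    A^T = A -> v != 0 -> v *m A = 0 -> 0 < (spectrum A)`_1 ->
    f *m v^T = 0 ->
  (spectrum A)`_1 * (f *m f^T) 0 0 <= (f *m A *m f^T) 0 0.
Proof.
set c := (spectrum A)`_1 => A_sym v0 vA c_gt0 fv.
(* The spectral theorem is applied over the complex numbers; the eigenvalues [d j] are real because
   the matrix is hermitian. *)
pose phi := real_complex R; pose A' := map_mx phi A.
have conj_phi m1 m2 (M : 'M[R]_(m1, m2)) : map_mx Num.conj (map_mx phi M) = map_mx phi M.
  apply/matrixP => i j; rewrite !mxE; exact: conjc_real.
have A'_herm : A' \is hermsymmx.
  apply/is_hermitianmxP; rewrite expr0 scale1r /A' map_trmx conj_phi A_sym //.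
have A'E := orthomx_spectralP (hermitian_normalmx A'_herm).
have P_unitary := spectral_unitarymx A'.
have := hermitian_spectral_diag_real A'_herm; move: A'E P_unitary.
set P := spectralmx A'; set D := spectral_diag A' => A'E P_unitary D_real.
have /choice[d dE] : forall j, exists x : R, D 0 j = phi x.
  by move=> j; apply/complex_realP; exact: (mxOverP D_real).
have PP : P *m map_mx Num.conj P^T = 1%:M by apply/unitarymxP.
have invP : invmx P = map_mx Num.conj P^T by rewrite invmx_unitary.
have P_unit : P \in unitmx by exact: unitarymx_unit.
have charA : char_poly A = \prod_(a <- [seq d j | j <- index_enum 'I_n]) ('X - a%:P).
  apply: (map_poly_inj phi); rewrite map_char_poly -/A'.
  rewrite big_map rmorph_prod /=;
  rewrite (eq_bigr (fun j => 'X - (D 0 j)%:P)) => [|j _]; last by rewrite dE map_polyXsubC.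
  pose P' := map_mx polyC P.
  have detP' : \det P' != 0 by rewrite det_map_mx polyC_eq0 -unitfE -unitmxE.
  apply: (mulfI detP'); rewrite -det_mulmx.
  have -> : P' *m char_poly_mx A' = char_poly_mx (diag_mx D) *m P'.
    rewrite /char_poly_mx mulmxBr mulmxBl scalar_mxC; congr (_ - _).
    rewrite -!map_mxM; congr map_mx.
    by rewrite A'E !mulmxA mulmxV // mul1mx.
  rewrite det_mulmx mulrC; congr (_ * _); rewrite -/(char_poly _).
  rewrite char_poly_trig ?diag_mx_is_trig //.
  by apply: eq_bigr => j _; rewrite mxE eqxx mulr1n.
(* In the sorted spectrum only the entry of index 0 can be below [c], the entry of index 1. *)
have few : (count (< c) [seq d j | j <- index_enum 'I_n] <= 1)%N.
  rewrite -(permP (spectrum_split charA)) -(cat_take_drop 1 (spectrum A)) count_cat.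
  rewrite (eqP (_ : count _ (drop 1 _) == 0%N)); last first.
    rewrite -leqn0 leqNgt -has_count; apply/hasPn => x /(nthP 0)[k].
    rewrite size_drop ltn_subRL nth_drop => lt_k <-; rewrite -leNgt.
    by apply: (sorted_leq_nth le_trans lexx _ (spectrum_sorted A)); rewrite ?inE //;
      apply: leq_ltn_trans lt_k; rewrite leq_addr.
  by rewrite addn0 (leq_trans (count_size _ _)) // size_take;
    case: ifP => // /negbT; rewrite -leqNgt.
pose coord (u : 'rV[R]_n) := map_mx phi u *m map_mx Num.conj P^T.
have coord_tr u : P *m (map_mx phi u)^T = map_mx Num.conj (coord u)^T.
  have -> : (coord u)^T = map_mx Num.conj P *m (map_mx phi u)^T.
    by rewrite trmx_mul -map_trmx trmxK.
  rewrite map_mxM -map_mx_comp map_trmx conj_phi; congr (_ *m _).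
  by apply/matrixP => i j; rewrite mxE /= conjCK.
have form u : phi ((u *m A *m u^T) 0 0) = \sum_j D 0 j * `|coord u 0 j| ^+ 2.
  transitivity ((map_mx phi (u *m A *m u^T)) 0 0); first by rewrite [RHS]mxE.
  rewrite !map_mxM -/A' A'E invP !mulmxA.
  rewrite -/(coord u).
  rewrite -mulmxA -map_trmx coord_tr.
  rewrite mul_mx_diag mxE; apply: eq_bigr => j _.
  by rewrite !mxE normCK mulrAC mulrC.
have dot u u' : phi ((u *m u'^T) 0 0) = \sum_j coord u 0 j * (coord u' 0 j)^*.
  transitivity ((map_mx phi (u *m u'^T)) 0 0); first by rewrite [RHS]mxE.
  rewrite map_mxM -[map_mx phi u]mulmx1 -(mulmx1C PP) mulmxA -mulmxA
    -[map_mx phi u'^T]map_trmx coord_tr.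
  by rewrite mxE; apply: eq_bigr => j _; rewrite !mxE.
have v_eig j : D 0 j * coord v 0 j = 0.
  have : coord v *m diag_mx D = 0.
    have : map_mx phi (v *m A) *m map_mx Num.conj P^T = 0 by rewrite vA map_mx0 mul0mx.
    by rewrite map_mxM -/A' A'E invP !mulmxA -mulmxA PP mulmx1.
  by move=> /rowP/(_ j); rewrite mul_mx_diag !mxE mulrC.
have [j0 vj0] : exists j0, coord v 0 j0 != 0.
  apply/rV0Pn; apply: contra v0 => /eqP cv0; apply/eqP.
  have /rowP v_eq0 : map_mx phi v = 0.
    by rewrite -[LHS]mulmx1 -(mulmx1C PP) mulmxA -/(coord v) cv0 mul0mx.
  by apply/rowP => j; apply: (@complexI R); have := v_eq0 j; rewrite !mxE.
have dj0 : d j0 = 0.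
  apply: (@complexI R); rewrite -/phi -dE.
  by have /eqP := v_eig j0; rewrite mulf_eq0 (negPf vj0) orbF => /eqP.
have d_ge j : j != j0 -> c <= d j.
  move=> jj0; rewrite leNgt; apply: contraL few => dj_lt; rewrite -ltnNge.
  rewrite count_map -sum1_count (bigD1 j0) /= ?dj0 //.
  by rewrite (bigD1 j) //= dj_lt.
have vj j : j != j0 -> coord v 0 j = 0.
  move=> jj0; have /eqP := v_eig j; rewrite mulf_eq0 => /orP[|/eqP //].
  rewrite dE (inj_eq (@complexI R) _ 0) => /eqP dj.
  by have := d_ge j jj0; rewrite dj leNgt c_gt0.
have fj0 : coord f 0 j0 = 0.
  have : \sum_j coord f 0 j * (coord v 0 j)^* = 0 by rewrite -dot fv mxE.
  rewrite (bigD1 j0) //= big1 ?addr0; last first.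
    by move=> j jj0; rewrite vj // conjC0 mulr0.
  by move=> /eqP; rewrite mulf_eq0 conjC_eq0 (negPf vj0) orbF => /eqP.
have phiM x y : phi (x * y) = phi x * phi y by exact: rmorphM.
rewrite -lecR -/phi form phiM dot mulr_sumr; apply: ler_sum => j _.
rewrite -normCK; have [->|jj0] := eqVneq j j0; first by rewrite fj0 normr0 expr0n !mulr0.
by rewrite ler_wpM2r ?exprn_ge0 // dE lecR d_ge.
Qed.

End Spectrum.

(** * Edge cuts and the second Laplacian eigenvalue *)

Section Cuts.
Variables (R : realType) (T : finType) (e : rel T).
Hypotheses (e_sym : symmetric e) (e_irr : irreflexive e).
Variable delta : nat.
Hypotheses (delta_min : forall v, (delta <= degree e v)%N) (delta_ge3 : (3 <= delta)%N).
Hypothesis mu2_gt : 2 < mu2 R e * delta.+1%:R.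

(** The ordered pairs leaving [X] count every boundary edge once. *)
Definition cut (X : {set T}) : nat :=
  #|[set p : T * T | [&& p.1 \in X, p.2 \notin X & e p.1 p.2]]|.

(** If [#|X| <= delta], each vertex of [X] has at least [delta.+1 - #|X|] neighbours outside, and
    [#|X| * (delta.+1 - #|X|) >= delta >= 3]. *)
Lemma cut_small_card (X : {set T}) : X != set0 -> (cut X <= 2)%N -> (delta < #|X|)%N.
Proof.
move=> X0 cutX; rewrite ltnNge; apply/negP => X_le.
have : (#|X| * (delta.+1 - #|X|) <= cut X)%N.
  have -> : cut X = (\sum_(u in X) #|[set v | e u v] :\: X|)%N.
    rewrite /cut -sum1_card
      (eq_bigl (fun p : T * T => (p.1 \in X) && (p.2 \in [set v | e p.1 v] :\: X))).
      rewrite -(pair_big_dep (mem X) (fun u v => v \in [set v | e u v] :\: X) (fun _ _ => 1%N)) /=.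
      by apply: eq_bigr => u _; rewrite sum1_card.
    by move=> p; rewrite !inE.
  rewrite -sum_nat_const; apply: leq_sum => u uX.
  have := cardsID X [set v | e u v]; rewrite -/(degree e u) => degE.
  have : (#|[set v | e u v] :&: X| <= #|X :\ u|)%N.
    apply: subset_leq_card; apply/subsetP => v; rewrite !inE => /andP[euv ->].
    by rewrite andbT; apply: contraTneq euv => ->; rewrite e_irr.
  have := delta_min u; rewrite -degE (cardsD1 u X) uX; lia.
have X_gt0 : (0 < #|X|)%N by rewrite card_gt0.
by move: #|X| X_le X_gt0 => x; nia.
Qed.

Lemma sum_rank (F : 'I_#|T| -> R) : \sum_i F i = \sum_u F (enum_rank u).
Proof. exact: (reindex _ (onW_bij _ (@enum_rank_bij T))). Qed.

(** The sum over ordered pairs meets every edge twice, whence the factor 2. *)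
Lemma laplacian_form (f : T -> R) : let w := \row_i f (enum_val i) in
  (w *m laplacian R e *m w^T) 0 0 *+ 2 = \sum_u \sum_v (e u v)%:R * (f u - f v) ^+ 2.
Proof.
move=> w; have subE (M N : 'M[R]_1) : (M - N) 0 0 = M 0 0 - N 0 0 by rewrite !mxE.
rewrite /laplacian mulmxBr mulmxBl subE mulrnBl.
have -> : (w *m degree_mx R e *m w^T) 0 0 = \sum_u \sum_v (e u v)%:R * f u ^+ 2.
  rewrite mul_mx_diag mxE sum_rank /=; apply: eq_bigr => u _.
  rewrite !mxE enum_rankK -mulr_suml -natr_sum /degree -sum1dep_card.
  rewrite big_mkcond mulrAC -expr2 mulrC.
  by congr (_%:R * _); apply: eq_bigr => v _; case: (e u v).
have -> : (w *m adjacency R e *m w^T) 0 0 = \sum_u \sum_v (e u v)%:R * (f u * f v).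
  rewrite mxE exchange_big sum_rank /=; apply: eq_bigr => v _.
  rewrite !mxE enum_rankK mulr_suml sum_rank /=.
  by apply: eq_bigr => u _; rewrite !mxE !enum_rankK; ring.
rewrite [X in X + _]mulr2n {2}exchange_big -sumrMnl -big_split -sumrB; apply: eq_bigr => u _.
rewrite -sumrMnl -big_split -sumrB; apply: eq_bigr => v _ /=.
by rewrite e_sym; ring.
Qed.

(** The bound [second_eigenvalue_le], with the all-ones vector in the kernel of the Laplacian. *)
Lemma mu2_test (f : T -> R) : \sum_u f u = 0 ->
  mu2 R e * (\sum_u f u ^+ 2) *+ 2 <= \sum_u \sum_v (e u v)%:R * (f u - f v) ^+ 2.
Proof.
move=> f0; rewrite -laplacian_form lerMn2r /=.
pose w : 'rV[R]_#|T| := \row_i f (enum_val i); pose one : 'rV[R]_#|T| := const_mx 1.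
have -> : \sum_u f u ^+ 2 = (w *m w^T) 0 0.
  by rewrite mxE sum_rank; apply: eq_bigr => u _; rewrite !mxE enum_rankK expr2.
(* A nonzero [w] provides an index, which makes the all-ones vector nonzero. *)
rewrite -/w; have [->|/rV0Pn[x _]] := eqVneq w 0; first by rewrite !mul0mx mxE mulr0.
have mu2_gt0 : 0 < mu2 R e.
  by have := lt_trans (ltr0n R 2) mu2_gt; rewrite pmulr_lgt0 ?ltr0n.
apply: (second_eigenvalue_le (v := one)) => //.
- rewrite linearB /= tr_diag_mx; congr (_ - _); apply/matrixP => i j.
  by rewrite !mxE e_sym.
- apply/rV0Pn; by exists x; rewrite mxE oner_eq0.
- apply/rowP => j; rewrite mulmxBr /degree_mx mul_mx_diag !mxE mul1r.
  rewrite sum_rank; under eq_bigr do rewrite !mxE mul1r enum_rankK.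
  rewrite -natr_sum /degree -sum1dep_card big_mkcond.
  apply/eqP; rewrite subr_eq0; apply/eqP; congr _%:R; apply: eq_bigr => u _.
  by rewrite e_sym; case: (e _ _).
- apply/matrixP => i j; rewrite !ord1 !mxE -[RHS]f0 sum_rank.
  by apply: eq_bigr => u _; rewrite !mxE enum_rankK mulr1.
Qed.

(* The test function takes the value [#|Y|] on [X] and [- #|X|] on [Y]. *)
Lemma mu2_two_sets (X Y : {set T}) (a b : R) : [disjoint X & Y] ->
  (forall u v, e u v ->
    (#|Y|%:R * (u \in X)%:R - #|X|%:R * (u \in Y)%:R
      - (#|Y|%:R * (v \in X)%:R - #|X|%:R * (v \in Y)%:R)) ^+ 2 <=
    a * ((u \in X) && (v \notin X) + (v \in X) && (u \notin X))%:R +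
    b * ((u \in Y) && (v \notin Y) + (v \in Y) && (u \notin Y))%:R) ->
  mu2 R e * (#|X| * #|Y| * (#|X| + #|Y|))%:R <= a * (cut X)%:R + b * (cut Y)%:R.
Proof.
move=> XY le_ab; pose f u : R := #|Y|%:R * (u \in X)%:R - #|X|%:R * (u \in Y)%:R.
have sum_in (Z : {set T}) : \sum_u (u \in Z)%:R = #|Z|%:R :> R.
  rewrite -natr_sum -sum1_card [in RHS]big_mkcond.
  by congr _%:R; apply: eq_bigr => u _; case: ifP.
have f0 : \sum_u f u = 0.
  by rewrite sumrB -!mulr_sumr !sum_in mulrC subrr.
have ff : \sum_u f u ^+ 2 = (#|X| * #|Y| * (#|X| + #|Y|))%:R.
  transitivity (#|Y|%:R ^+ 2 * \sum_u (u \in X)%:R + #|X|%:R ^+ 2 * \sum_u (u \in Y)%:R : R).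
    rewrite !mulr_sumr -big_split; apply: eq_bigr => u _ /=; rewrite /f.
    have := disjointFr XY (x := u); case: (u \in X) => [/(_ isT) ->|_]; first by rewrite /=; ring.
    by case: (u \in Y) => /=; ring.
  by rewrite !sum_in !natrM natrD; ring.
have sum_cut (Z : {set T}) :
    \sum_u \sum_v (e u v)%:R * ((u \in Z) && (v \notin Z) + (v \in Z) && (u \notin Z))%:R
    = (cut Z)%:R *+ 2 :> R.
  have cutE : (cut Z)%:R = \sum_u \sum_v (e u v)%:R * ((u \in Z) && (v \notin Z))%:R :> R.
    rewrite pair_big /= /cut -sum1dep_card big_mkcond natr_sum; apply: eq_bigr => -[u v] _ /=.
    by case: (e u v); case: (u \in Z); case: (v \in Z); rewrite /= ?mul0r ?mul1r.
  have cutE' := cutE; rewrite exchange_big /= in cutE'.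
  rewrite mulr2n {1}cutE cutE' -big_split; apply: eq_bigr => u _.
  rewrite -big_split; apply: eq_bigr => v _ /=.
  by rewrite natrD mulrDr (e_sym v u).
have := mu2_test f0; rewrite ff => mu2_le.
rewrite -(@ler_pMn2r _ 2) //; apply: le_trans mu2_le _.
rewrite mulrnDl -!mulrnAr -!sum_cut !mulr_sumr -big_split; apply: ler_sum => u _ /=.
rewrite !mulr_sumr -big_split; apply: ler_sum => v _ /=.
have [euv|] := boolP (e u v); last by rewrite !mul0r !mulr0 addr0.
by rewrite !mul1r; exact: le_ab.
Qed.

Lemma mu2_mul_gt (x y : nat) : (delta < x)%N -> (0 < y)%N ->
  2 * y%:R < mu2 R e * (x%:R * y%:R).
Proof.
move=> x_gt y_gt0.
have mu2_gt0 : 0 < mu2 R e.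
  by have := lt_trans (ltr0n R 2) mu2_gt; rewrite pmulr_lgt0 ?ltr0n.
rewrite mulrA ltr_pM2r ?ltr0n //; apply: lt_le_trans mu2_gt _.
by rewrite ler_pM2l // ler_nat.
Qed.

(** With [x] and [y] the sizes of [X] and its complement, the test gives
    [mu2 * x * y <= (x + y) * cut X]. If [cut X <= 1], both sizes exceed [delta], so [mu2 * x * y]
    is above [2 * x] and [2 * y], hence above [x + y]. *)
Lemma cut_ge2 (X : {set T}) : X != set0 -> X != setT -> (2 <= cut X)%N.
Proof.
move=> X0 XT; rewrite leqNgt; apply/negP => cutX.
have CX0 : ~: X != set0 by apply: contra XT => /eqP C0; rewrite -[X]setCK C0 setC0.
have cutC : cut (~: X) = cut X.
  pose swap (p : T * T) := (p.2, p.1).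
  have swapK : involutive swap by case.
  rewrite /cut -(card_imset _ (inv_inj swapK)); apply: eq_card => -[u v].
  apply/imsetP/idP => [[[u' v'] uv' E]|uv].
    have /= -> := congr1 fst E; have /= -> := congr1 snd E.
    by move: uv'; rewrite !inE /= negbK e_sym => /and3P[-> -> ->].
  exists (v, u) => //; move: uv; rewrite !inE /= negbK e_sym => /and3P[-> -> ->] //.
have x_gt : (delta < #|X|)%N by apply: cut_small_card X0 _; lia.
have y_gt : (delta < #|~: X|)%N by apply: cut_small_card CX0 _; rewrite cutC; lia.
have : mu2 R e * (#|X| * #|~: X| * (#|X| + #|~: X|))%:R <=
    (#|X| + #|~: X|)%:R ^+ 2 * (cut X)%:R + 0 * (cut (~: X))%:R.
  apply: mu2_two_sets => [|u v _]; first by rewrite disjoints_subset setCK.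
  rewrite mul0r addr0 !inE natrD.
  by case: (u \in X); case: (v \in X); rewrite /=; lra.
rewrite mul0r addr0; apply/negP; rewrite -ltNge !natrM !natrD.
have h1 := mu2_mul_gt x_gt (leq_trans (ltn0Sn _) y_gt).
have h2 := mu2_mul_gt y_gt (leq_trans (ltn0Sn _) x_gt).
have x0 : 0 < #|X|%:R :> R by rewrite ltr0n; lia.
have y0 : 0 < #|~: X|%:R :> R by rewrite ltr0n; lia.
have cutX1 : (cut X)%:R <= 1 :> R by rewrite lern1.
move: h1 h2 x0 y0 cutX1; move: #|X|%:R #|~: X|%:R (mu2 R e) (cut X)%:R.
move=> x y m d h1 h2 x0 y0 d1.
apply: (@le_lt_trans _ _ ((x + y) * (x + y))).
  rewrite expr2 -[leRHS]mulr1 ler_wpM2l //; nra.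
by rewrite [ltRHS]mulrA ltr_pM2r; lra.
Qed.

(** Without an edge between them, each edge leaving [X] contributes [y ^+ 2] and each edge leaving
    [Y] contributes [x ^+ 2], where [x] and [y] are the sizes. The total, at most
    [2 * (x ^+ 2 + y ^+ 2)], is below [mu2 * x * y * (x + y)]. *)
Lemma small_cuts_adjacent (X Y : {set T}) : X != set0 -> Y != set0 -> [disjoint X & Y] ->
  (cut X <= 2)%N -> (cut Y <= 2)%N -> exists u v, [/\ u \in X, v \in Y & e u v].
Proof.
move=> X0 Y0 XY cutX cutY; apply: contrapT => no_edge.
have x_gt := cut_small_card X0 cutX; have y_gt := cut_small_card Y0 cutY.
have : mu2 R e * (#|X| * #|Y| * (#|X| + #|Y|))%:R <=
    #|Y|%:R ^+ 2 * (cut X)%:R + #|X|%:R ^+ 2 * (cut Y)%:R.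
  apply: mu2_two_sets => // u v euv.
  have uXvY : ~~ ((u \in X) && (v \in Y)).
    by apply/negP => /andP[uX vY]; apply: no_edge; exists u, v.
  have vXuY : ~~ ((v \in X) && (u \in Y)).
    by apply/negP => /andP[vX uY]; apply: no_edge; exists v, u; rewrite e_sym.
  have uXY : ~~ ((u \in X) && (u \in Y)).
    by apply/negP => /andP[uX]; rewrite (disjointFr XY uX).
  have vXY : ~~ ((v \in X) && (v \in Y)).
    by apply/negP => /andP[vX]; rewrite (disjointFr XY vX).
  move: uXvY vXuY uXY vXY.
  by case: (u \in X); case: (v \in X); case: (u \in Y); case: (v \in Y) => //= _ _ _ _; lra.
apply/negP; rewrite -ltNge !natrM !natrD.
have h1 := mu2_mul_gt x_gt (leq_trans (ltn0Sn _) y_gt).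
have h2 := mu2_mul_gt y_gt (leq_trans (ltn0Sn _) x_gt).
have x0 : 0 < #|X|%:R :> R by rewrite ltr0n; lia.
have y0 : 0 < #|Y|%:R :> R by rewrite ltr0n; lia.
have cX : (cut X)%:R <= 2 :> R by rewrite (ler_nat _ _ 2).
have cY : (cut Y)%:R <= 2 :> R by rewrite (ler_nat _ _ 2).
move: h1 h2 x0 y0 cX cY; move: #|X|%:R #|Y|%:R (mu2 R e) (cut X)%:R (cut Y)%:R.
move=> x y m d1 d2 h1 h2 x0 y0 dX dY.
have hx : x ^+ 2 * d2 <= x ^+ 2 * 2 by rewrite ler_wpM2l ?sqr_ge0.
have hy : y ^+ 2 * d1 <= y ^+ 2 * 2 by rewrite ler_wpM2l ?sqr_ge0.
have kx : 2 * x * x < m * (y * x) * x by rewrite ltr_pM2r.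
have ky : 2 * y * y < m * (x * y) * y by rewrite ltr_pM2r.
nra.
Qed.

Variables (C : finType) (c : T -> C).

Lemma sum_cut_crossing :
  (\sum_(i in c @: T) cut (c @^-1: [set i]) <= 2 * #|crossing e c|)%N.
Proof.
pose B := [set p : T * T | (c p.1 != c p.2) && e p.1 p.2].
have -> : (\sum_(i in c @: T) cut (c @^-1: [set i]))%N = #|B|.
  rewrite -sum1_card (partition_big (fun p : T * T => c p.1) (mem (c @: T))) /=; last first.
    by move=> p _; rewrite imset_f.
  apply: eq_bigr => i _; rewrite sum1dep_card; apply: eq_card => p.
  rewrite !inE; have [->|//] := eqVneq (c p.1) i; last by rewrite andbF.
  by rewrite andbT eq_sym.
(* An ordered pair is recorded as its edge and its orientation relative to [enum_rank]. *)
pose pr (p : T * T) := ([set p.1; p.2], (enum_rank p.1 < enum_rank p.2)%N).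
have pr_inj : {in B &, injective pr}.
  move=> [u v] [u' v']; rewrite !inE /= => /andP[cuv _] _ [E].
  have := in_setU1 u u [set v]; have := set22 u v; have := set21 u v.
  rewrite E !inE => /pred2P[] uE /pred2P[] vE; rewrite ?uE ?vE // in cuv *;
    rewrite ?eqxx // in cuv.
  move=> _; case: ltngtP => // /val_inj/enum_rank_inj vu; by rewrite vu eqxx in cuv.
rewrite -(card_in_imset pr_inj) -(card_imset (crossing e c) val_inj) mulnC -card_bool
  -cardsT -cardsX.
apply: subset_leq_card; apply/subsetP => _ /imsetP[[u v] uvB ->].
rewrite inE in_setT andbT /=; move: uvB; rewrite inE /= => /andP[cuv euv].
have f_edge : [set u; v] \in edges e by apply/imsetP; exists (u, v); rewrite ?inE.
apply/imsetP; exists (exist (fun E : {set T} => E \in edges e) _ f_edge) => //.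
by rewrite inE; apply/exists_inP; exists u; rewrite ?set21 //;
  apply/exists_inP; exists v; rewrite ?set22.
Qed.

(** [S] collects the classes with at most two boundary edges. Three of them form a triangle by
    [small_cuts_adjacent]. Otherwise all but two classes have three boundary edges or more, and with
    [k] classes twice the number of crossing edges is at least [3 * k - 2]. *)
Lemma crossing_large_or_triangle : (1 < #|c @: T|)%N ->
  (3 * #|c @: T|.-1 < 2 * #|crossing e c|)%N \/
  exists x y z : C, [/\ x != y, y != z & z != x] /\
    forall a b, a \in [:: x; y; z] -> b \in [:: x; y; z] -> a != b ->
    exists (f : edge e) (u v : T), [/\ u \in val f, v \in val f, c u = a & c v = b].
Proof.
move=> k_gt1; pose S := [set i in c @: T | (cut (c @^-1: [set i]) <= 2)%N].
have ne i : i \in c @: T -> c @^-1: [set i] != set0.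
  by move=> /imsetP[u _ ->]; apply/set0Pn; exists u; rewrite !inE.
have [S_le|/card_gt2P[x [y [z [[xS yS zS] [xy yz zx]]]]]] := leqP #|S| 2.
  left; apply: leq_trans sum_cut_crossing.
  have : (\sum_(i in c @: T) (3 - (i \in S)) <= \sum_(i in c @: T) cut (c @^-1: [set i]))%N.
    apply: leq_sum => i ic; rewrite inE ic /=.
    have : (2 <= cut (c @^-1: [set i]))%N; last by case: leqP => /=; lia.
    apply: cut_ge2; first exact: ne.
    apply: contraTneq k_gt1 => iT; rewrite -leqNgt -(cards1 i) subset_leq_card //.
    by apply/subsetP => _ /imsetP[u _ ->]; have := in_setT u; rewrite -iT !inE.
  have : (\sum_(i in c @: T) (3 - (i \in S)) + \sum_(i in c @: T) (i \in S) = 3 * #|c @: T|)%N.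
    by rewrite -big_split /= mulnC -sum_nat_const; apply: eq_bigr => i _; case: (i \in S).
  have : (\sum_(i in c @: T) (i \in S) <= #|S|)%N.
    rewrite -sum1_card [leqRHS]big_mkcond [leqLHS]big_mkcond /=.
    by apply: leq_sum => i _; case: (i \in c @: T); case: (i \in S).
  lia.
right; exists x, y, z; split=> // a b.
have inS i : i \in [:: x; y; z] -> i \in S.
  by rewrite !inE => /or3P[] /eqP ->; rewrite -?(inE _ S); move: xS yS zS; rewrite !inE.
move=> /inS aS /inS bS ab; move: aS bS; rewrite !inE => /andP[ac acut] /andP[bc bcut].
have [|u [v []]] := small_cuts_adjacent (ne a ac) (ne b bc) _ acut bcut.
  by rewrite disjoints_subset; apply/subsetP => u; rewrite !inE => /eqP ->.
rewrite !inE => /eqP ua /eqP vb euv.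
have f_edge : [set u; v] \in edges e by apply/imsetP; exists (u, v); rewrite ?inE.
exists (exist (fun E : {set T} => E \in edges e) _ f_edge), u, v.
by split; rewrite ?set21 ?set22.
Qed.

End Cuts.

(** * Three pairwise adjacent classes *)

Section Triangle.
Variables (R : realType) (T : finType) (e : rel T) (n : nat).
Variable h : framework R n.+1 e.
Hypothesis h_gen : generic h.
Implicit Types G : 'M[R]_n.+1 * 'rV[R]_n.+1.

Definition hinge_point (a : edge e * 'I_n) : 'rV[R]_n.+1 := h a.1 a.2.

(** Distinct hinge points have disjoint coordinates, so [generic_det_neq0] shows that [n + 2] of
    them are affinely independent. *)
Lemma affine_basis_unit (a : 'I_n.+1 -> edge e * 'I_n) (b : edge e * 'I_n) :
  injective a -> (forall i, a i != b) ->
  \matrix_i (hinge_point (a i) - hinge_point b) \in unitmx.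
Proof.
move=> a_inj ab; rewrite unitmxE unitfE.
have := generic_det_neq0 h_gen (a := fun i j => ((a i), j)) (b := fun j => Some (b, j)).
rewrite (_ : \matrix_(i, j) _ = \matrix_i (hinge_point (a i) - hinge_point b)); last first.
  by apply/matrixP => i j; rewrite !mxE.
apply=> [i j k l E|i j [E]].
  by have := congr1 fst E; have /= -> := congr1 snd E; move=> /= /a_inj ->.
by have := ab i; rewrite -E eqxx.
Qed.

Lemma affine_basis_eq0 m (a : 'I_n.+1 -> edge e * 'I_n) (b : edge e * 'I_n)
    (M : 'M[R]_(n.+1, m)) :
  injective a -> (forall i, a i != b) ->
  (forall i, (hinge_point (a i) - hinge_point b) *m M = 0) -> M = 0.
Proof.
move=> a_inj ab M0; apply: (can_inj (mulKmx (affine_basis_unit a_inj ab))).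
by rewrite mulmx0; apply/row_matrixP => i; rewrite row_mul rowK row0 M0.
Qed.

(** Two hinges have [2 * n >= n + 2] points, enough for an affine basis. *)
Lemma two_hinges_span m (f f' : edge e) (M : 'M[R]_(n.+1, m)) : (1 < n)%N -> f != f' ->
  (forall a b : edge e * 'I_n, a.1 \in [:: f; f'] -> b.1 \in [:: f; f'] ->
    (hinge_point a - hinge_point b) *m M = 0) -> M = 0.
Proof.
move=> n_gt1 ff' M0.
have n_gt0 : (0 < n)%N by exact: ltnW.
have [k kK] : exists k : nat -> 'I_n, forall i, (i < n)%N -> k i = i :> nat.
  by exists (insubd (Ordinal n_gt0)) => i i_n; rewrite insubdK.
(* With the base point [(f, k 0)], these are the other [n - 1] points of [f] and two points of
   [f']. *)
pose a (i : 'I_n.+1) : edge e * 'I_n :=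
  if (i.+1 < n)%N then (f, k i.+1) else (f', k (i - n.-1)%N).
have in_f i : (a i).1 \in [:: f; f'].
  by rewrite /a; case: ifP; rewrite !inE eqxx ?orbT.
apply: (@affine_basis_eq0 _ a (f, k 0)) => [i j|i|i]; last by apply: M0; rewrite ?in_f ?mem_head.
- have lt_i := ltn_ord i; have lt_j := ltn_ord j.
  rewrite /a; case: ltnP => i_n; case: ltnP => j_n E; apply: val_inj => /=.
  + by have := congr1 (fun b : edge e * 'I_n => nat_of_ord b.2) E; rewrite /= !kK // => -[].
  + by have /= ffE := congr1 fst E; rewrite ffE eqxx in ff'.
  + by have /= ffE := congr1 fst E; rewrite ffE eqxx in ff'.
  + have := congr1 (fun b : edge e * 'I_n => nat_of_ord b.2) E; rewrite /= !kK; lia.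
- rewrite /a; case: ltnP => i_n; apply/eqP => E.
    by have := congr1 (fun b : edge e * 'I_n => nat_of_ord b.2) E; rewrite /= !kK.
  by have /= ffE := congr1 fst E; rewrite ffE eqxx in ff'.
Qed.

(** The expanded form of the fact that [r] and its image are at the same distance from the fixed
    point [p]. *)
Lemma equidistant G p r : G.1 *m G.1^T = 1%:M -> act G p = p ->
  let w := act G r - r in (w *m w^T) 0 0 + 2 * (w *m (r - p)^T) 0 0 = 0.
Proof.
move=> oG Gp w; have E : w + (r - p) = (r - p) *m G.1.
  by rewrite /w addrA subrK -[X in _ - X = _]Gp /act mulmxBl opprD addrACA subrr addr0.
have : (w + (r - p)) *m (w + (r - p))^T = (r - p) *m (r - p)^T.
  by rewrite {1 2}E trmx_mul mulmxA -(mulmxA (r - p)) oG mulmx1.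
have -> (u v : 'rV[R]_n.+1) : (u + v) *m (u + v)^T =
    u *m u^T + u *m v^T + (u *m v^T)^T + v *m v^T.
  by rewrite trmx_mul trmxK linearD mulmxDl !mulmxDr !addrA.
move=> /(congr1 (fun M : 'M_1 => M 0 0)).
have addE (M N : 'M[R]_1) : (M + N) 0 0 = M 0 0 + N 0 0 by rewrite mxE.
rewrite !addE [X in _ + X + _]mxE; lra.
Qed.

(** Seen from the first body, [Q2] fixes [f1], [Q3] fixes [f2], and they agree on [f3]. So the image
    of a point of [f3] keeps its distances to all points of [f1] and [f2], which affinely span the
    space; hence it does not move. Now [Q2] fixes [f1] and [f3], which span too. *)
Lemma three_hinges_spatial G1 G2 G3 (f1 f2 f3 : edge e) : (1 < n)%N ->
  f1 != f2 -> f1 != f3 ->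
  G1.1 *m G1.1^T = 1%:M -> G2.1 *m G2.1^T = 1%:M -> G3.1 *m G3.1^T = 1%:M ->
  (forall i, act G1 (h f1 i) = act G2 (h f1 i)) ->
  (forall i, act G1 (h f2 i) = act G3 (h f2 i)) ->
  (forall i, act G2 (h f3 i) = act G3 (h f3 i)) -> G1 = G2.
Proof.
move=> n_gt1 f12 f13 o1 o2 o3 E1 E2 E3.
pose Q2 := relative G1 G2; pose Q3 := relative G1 G3.
have oQ2 := relative_orthogonal o1 o2; have oQ3 := relative_orthogonal o1 o3.
have fix2 i : act Q2 (h f1 i) = h f1 i by apply: act_relative o1 (esym (E1 i)).
have fix3 i : act Q3 (h f2 i) = h f2 i by apply: act_relative o1 (esym (E2 i)).
have Q23 i : act Q2 (h f3 i) = act Q3 (h f3 i).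
  move: (E3 i); rewrite /act /= !mulmxA -!mulmxDl !addrA. by move=> ->.
have fix2' i : act Q2 (h f3 i) = h f3 i.
  apply/eqP; rewrite -subr_eq0 -trmx_eq0; apply/eqP.
  apply: (two_hinges_span n_gt1 f12) => a b af bf.
  pose w := act Q2 (h f3 i) - h f3 i.
  have wE a' : a'.1 \in [:: f1; f2] ->
      (w *m w^T) 0 0 + 2 * (w *m (h f3 i - hinge_point a')^T) 0 0 = 0.
    case: a' => f' j; rewrite !inE => /orP[] /eqP /= ->.
      exact: (equidistant (h f3 i) oQ2 (fix2 j)).
    by rewrite /w Q23; exact: (equidistant (h f3 i) oQ3 (fix3 j)).
  rewrite -/w; apply: trmx_inj; rewrite trmx_mul trmxK trmx0 [LHS]mx11_scalar.
  apply/matrixP => x y; rewrite !ord1 mxE [RHS]mxE eqxx mulr1n.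
  have := wE a af; have := wE b bf; rewrite !linearB /=.
  have subE (M N : 'M[R]_1) : (M - N) 0 0 = M 0 0 - N 0 0 by rewrite !mxE.
  rewrite !subE; lra.
apply: (relative_eq1 (p := h f1 (Ordinal (ltnW n_gt1))) o1 (E1 _)).
apply/eqP; rewrite -subr_eq0; apply/eqP.
apply: (two_hinges_span n_gt1 f13) => a b af bf.
have fixa a' : a'.1 \in [:: f1; f3] -> hinge_point a' *m (Q2.1 - 1%:M) = - Q2.2.
  move=> a'f; rewrite mulmxBr mulmx1.
  have {2}<- : act Q2 (hinge_point a') = hinge_point a'.
    by case: a' a'f => f' j; rewrite !inE => /orP[] /eqP /= ->; [exact: fix2|exact: fix2'].
  by rewrite /act opprD addNKr.
by rewrite mulmxBl !fixa // subrr.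
Qed.

End Triangle.

(** * The triangle argument in the plane *)

Section PlanarTriangle.
Variable R : realType.
Implicit Types G : 'M[R]_2 * 'rV[R]_2.

(** The condition that [close] imposes on each single body. *)
Definition near_identity (eps : R) d (G : 'M[R]_d * 'rV[R]_d) : Prop :=
  (forall i j, `|G.1 i j - (1%:M : 'M[R]_d) i j| < eps) /\ (forall j, `|G.2 0 j| < eps).

(** The determinant is 1 or -1, and at least [9 / 16 - 1 / 16]. *)
Lemma near_identity_det eps G : eps <= 1 / 4 -> near_identity eps G ->
  G.1 *m G.1^T = 1%:M -> \det G.1 = 1.
Proof.
move=> eps_le [near_id _] oG.
have n00 := near_id 0 0; have n01 := near_id 0 1.
have n10 := near_id 1 0; have n11 := near_id 1 1.
have det_gt0 : 0 < \det G.1.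
  rewrite det_mx2; move: n00 n01 n10 n11; rewrite !mxE /=.
  move: (G.1 0 0) (G.1 0 1) (G.1 1 0) (G.1 1 1) => a b c d.
  rewrite !ltr_norml => /andP[? ?] /andP[? ?] /andP[? ?] /andP[? ?].
  have : (3 / 4) ^+ 2 <= a * d by rewrite expr2 ler_pM //; lra.
  have : `|b * c| <= (1 / 4) * (1 / 4).
    by rewrite normrM ler_pM // ler_norml; apply/andP; split; lra.
  rewrite ler_norml => /andP[_ ?] ?; lra.
have := congr1 determinant oG; rewrite det_mulmx det_tr det1 => /eqP.
by rewrite -expr2 sqrf_eq1 => /orP[/eqP //|/eqP det_lt0]; rewrite det_lt0 in det_gt0; lra.
Qed.

(** For the reflection in the line along [q], the displacement [w] of a point at position [s] is
    twice its distance to the line. *)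
Lemma planar_reflection_norm (w q s : 'rV[R]_2) :
  w != 0 -> (w *m q^T) 0 0 = 0 -> (w *m w^T) 0 0 + 2 * (w *m s^T) 0 0 = 0 ->
  (q *m q^T) 0 0 * (w *m w^T) 0 0 = 4 * (q 0 0 * s 0 1 - q 0 1 * s 0 0) ^+ 2.
Proof.
have dotE (u v : 'rV[R]_2) : (u *m v^T) 0 0 = u 0 0 * v 0 0 + u 0 1 * v 0 1.
  rewrite mxE big_ord_recr big_ord1 /= !mxE.
  by congr (u _ _ * v _ _ + u _ _ * v _ _); apply: val_inj.
rewrite -row_norm_eq0 !dotE.
move: (w 0 0) (w 0 1) (q 0 0) (q 0 1) (s 0 0) (s 0 1) => w0 w1 a b c d ww E1 E2.
have Ea : (w0 * c + w1 * d) * a = w1 * (a * d - b * c).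
  have -> : (w0 * c + w1 * d) * a = w1 * (a * d - b * c) + (w0 * a + w1 * b) * c by ring.
  by rewrite E1 mul0r addr0.
have Eb : (w0 * c + w1 * d) * b = - (w0 * (a * d - b * c)).
  have -> : (w0 * c + w1 * d) * b = - (w0 * (a * d - b * c)) + (w0 * a + w1 * b) * d by ring.
  by rewrite E1 mul0r addr0.
have E3 : w0 * w0 + w1 * w1 = - (2 * (w0 * c + w1 * d)) by lra.
apply: (mulfI ww).
transitivity (4 * (((w0 * c + w1 * d) * a) ^+ 2 + ((w0 * c + w1 * d) * b) ^+ 2)).
  rewrite E3; ring.
rewrite Ea Eb; ring.
Qed.

(** Distances to [p] and [q] determine [r] up to the reflection in their line. The reflection moves
    [r] by a fixed positive amount, too much for congruences close to the identity. *)
Lemma close_planar_triangle (p q r : 'rV[R]_2) :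
  (q - p) 0 0 * (r - p) 0 1 - (q - p) 0 1 * (r - p) 0 0 != 0 ->
  exists2 eps0 : R, 0 < eps0 & forall eps G1 G2 G3, eps <= eps0 ->
    near_identity eps G1 -> near_identity eps G2 ->
    G1.1 *m G1.1^T = 1%:M -> G2.1 *m G2.1^T = 1%:M -> G3.1 *m G3.1^T = 1%:M ->
    act G1 p = act G2 p -> act G1 q = act G3 q -> act G2 r = act G3 r -> G1 = G2.
Proof.
set D := (X in X != 0) => D0.
pose N := ((q - p) *m (q - p)^T) 0 0; pose K := `|r 0 0| + `|r 0 1| + 1.
have N_ge0 : 0 <= N.
  by rewrite /N mxE sumr_ge0 // => i _; rewrite !mxE -expr2 sqr_ge0.
pose M := N * (8 * K ^+ 2).
have M_ge0 : 0 <= M by rewrite mulr_ge0 // mulr_ge0 ?sqr_ge0.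
have D2 : 0 < 4 * D ^+ 2 by rewrite mulr_gt0 // exprn_even_gt0.
(* The bound [1 / 4] makes the determinants 1; the other one gives [M * eps < 4 * D ^+ 2], against
   [planar_reflection_norm]. *)
exists (Num.min (1 / 4) (4 * D ^+ 2 / (M + 1))).
  by rewrite lt_min divr_gt0 ?divr_gt0 //; lra.
move=> eps G1 G2 G3; rewrite le_min => /andP[eps_le eps_leD] near1 near2 o1 o2 o3 E1 E2 E3.
pose Q2 := relative G1 G2; pose Q3 := relative G1 G3.
have oQ2 := relative_orthogonal o1 o2; have oQ3 := relative_orthogonal o1 o3.
have fix2 : act Q2 p = p by apply: act_relative o1 (esym E1).
have fix3 : act Q3 q = q by apply: act_relative o1 (esym E2).
have Q23 : act Q2 r = act Q3 r.
  by move: E3; rewrite /act /= !mulmxA -!mulmxDl !addrA => ->.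
pose w := act Q2 r - r.
have w2 : (w *m w^T) 0 0 + 2 * (w *m (r - p)^T) 0 0 = 0 := equidistant r oQ2 fix2.
have w3 : (w *m w^T) 0 0 + 2 * (w *m (r - q)^T) 0 0 = 0.
  by rewrite /w Q23; exact: (equidistant r oQ3 fix3).
have wqp : (w *m (q - p)^T) 0 0 = 0.
  have subE (A B : 'M[R]_1) : (A - B) 0 0 = A 0 0 - B 0 0 by rewrite !mxE.
  by move: w2 w3; rewrite !linearB /= !subE; lra.
have w0 : w = 0.
  apply/eqP; apply/negPn/negP => w_neq0.
  (* Closeness bounds [w']; the orthogonal matrix [G1.1] maps [w] to [w'], so both have the same
     norm. *)
  pose w' := act G2 r - act G1 r.
  have w'E : w *m G1.1 = w'.
    have -> : w = (act G2 r - G1.2) *m G1.1^T - r.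
      by rewrite /w /act /= mulmxA -mulmxDl addrA.
    rewrite mulmxBl -mulmxA (orthogonal_tr o1) mulmx1 /w'.
    by rewrite [act G1 r]addrC opprD addrA.
  have ww' : w *m w^T = w' *m w'^T.
    by rewrite -w'E trmx_mul mulmxA -(mulmxA w) o1 mulmx1.
  have eps_gt0 : 0 < eps by apply: le_lt_trans (near1.2 0).
  have K_ge1 : 1 <= K by rewrite /K lerDr addr_ge0.
  have w'_le j : `|w' 0 j| <= 2 * eps * K.
    have -> : w' 0 j = r 0 0 *
          ((G2.1 0 j - (1%:M : 'M[R]_2) 0 j) - (G1.1 0 j - (1%:M : 'M[R]_2) 0 j))
        + r 0 1 * ((G2.1 1 j - (1%:M : 'M[R]_2) 1 j) - (G1.1 1 j - (1%:M : 'M[R]_2) 1 j))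
        + (G2.2 0 j - G1.2 0 j).
      have actE G : act G r 0 j = r 0 0 * G.1 0 j + r 0 1 * G.1 1 j + G.2 0 j.
        rewrite !mxE big_ord_recr big_ord1 /=.
        by congr (r _ _ * G.1 _ _ + r _ _ * G.1 _ _ + _); apply: val_inj.
      have -> : w' 0 j = act G2 r 0 j - act G1 r 0 j by rewrite /w' !mxE.
      by rewrite !actE; ring.
    have le2 (x y : R) : `|x| < eps -> `|y| < eps -> `|x - y| <= 2 * eps.
      by move=> xe ye; apply: le_trans (ler_normB _ _) _; lra.
    have -> : 2 * eps * K = `|r 0 0| * (2 * eps) + `|r 0 1| * (2 * eps) + 2 * eps.
      by rewrite /K; ring.
    apply: le_trans (ler_normD _ _) (lerD _ _).
      apply: le_trans (ler_normD _ _) (lerD _ _); rewrite normrM ler_wpM2l //.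
        by apply: le2; [exact: near2.1|exact: near1.1].
      by apply: le2; [exact: near2.1|exact: near1.1].
    by apply: le2; [exact: near2.2|exact: near1.2].
  have ww_le : (w *m w^T) 0 0 <= 8 * K ^+ 2 * eps ^+ 2.
    have le_sq j : w' 0 j * w' 0 j <= 4 * K ^+ 2 * eps ^+ 2.
      rewrite -expr2 -real_normK ?num_real // (_ : _ * eps ^+ 2 = (2 * eps * K) ^+ 2); last by ring.
      by rewrite lerXn2r ?nnegrE // !mulr_ge0 //; lra.
    have -> : 8 * K ^+ 2 * eps ^+ 2 = \sum_(j < 2) 4 * K ^+ 2 * eps ^+ 2.
      by rewrite sumr_const card_ord mulr2n; ring.
    by rewrite ww' mxE; apply: ler_sum => j _; rewrite [w'^T _ _]mxE.
  have := planar_reflection_norm w_neq0 wqp w2; rewrite -/D -/N => NE.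
  have : N * (w *m w^T) 0 0 < 4 * D ^+ 2; last by rewrite NE ltxx.
  apply: (@le_lt_trans _ _ (M * eps ^+ 2)).
    by rewrite /M -mulrA ler_wpM2l.
  apply: (@le_lt_trans _ _ (M * eps)).
    by rewrite ler_wpM2l // expr2 ler_piMl //; lra.
  apply: (@le_lt_trans _ _ (M * (4 * D ^+ 2 / (M + 1)))); first by rewrite ler_wpM2l.
  by rewrite mulrA ltr_pdivrMr; nra.
have fixr : act Q2 r = r by apply/eqP; rewrite -subr_eq0 -/w w0.
have detQ : \det Q2.1 = 1.
  rewrite det_mulmx det_tr (near_identity_det eps_le near1 o1).
  by rewrite (near_identity_det eps_le near2 o2) mulr1.
(* A plane rotation fixing the distinct points [p] and [r] is trivial. *)
apply: (relative_eq1 o1 E1); apply/eqP/negPn/negP => A1.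
have A1_unit := plane_rotation_sub1_unit oQ2 detQ A1.
have : (r - p) *m (Q2.1 - 1%:M) = 0.
  rewrite mulmxBr mulmx1 mulmxBl.
  have -> : r *m Q2.1 = r - Q2.2 by apply: (canRL (addrK _)); exact: fixr.
  have -> : p *m Q2.1 = p - Q2.2 by apply: (canRL (addrK _)); exact: fix2.
  by rewrite opprB addrA subrK subrr.
move=> rp0; have rp : r - p = 0 by rewrite -(mulmxK A1_unit (r - p)) rp0 mul0mx.
by move: D0; rewrite /D rp !mxE !mulr0 subrr eqxx.
Qed.

End PlanarTriangle.

(** * Rigidity of generic frameworks from the eigenvalue bound *)

Section Conclusion.
Variables (R : realType) (T : finType) (e : rel T).
Hypotheses (e_sym : symmetric e) (e_irr : irreflexive e).
Variable delta : nat.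
Hypotheses (delta_min : forall v, (delta <= degree e v)%N) (delta_ge3 : (3 <= delta)%N).
Hypothesis mu2_gt : 2 < mu2 R e * delta.+1%:R.

Lemma edge_colors (C : eqType) (c : T -> C) (f : edge e) (u v w : T) :
  u \in val f -> v \in val f -> w \in val f -> c u != c v -> c v != c w -> c w = c u.
Proof.
case: f => E /= /imsetP[[x y] _ ->]; rewrite !inE /=.
move=> /pred2P[] -> /pred2P[] -> /pred2P[] ->; rewrite ?eqxx //.
Qed.

(** The triangle argument enters as the last hypothesis because it differs between the plane and
    higher dimensions. *)
Lemma arrangement_congruent n (h : framework R n.+1 e) g : (0 < n)%N ->
  generic h -> arrangement h g ->
  (n = 1%N -> forall v, \det (g v).1 = 1) ->
  (forall u v w (f1 f2 f3 : edge e), f1 != f2 -> f1 != f3 -> f2 != f3 ->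
    (forall i, act (g u) (h f1 i) = act (g v) (h f1 i)) ->
    (forall i, act (g u) (h f2 i) = act (g w) (h f2 i)) ->
    (forall i, act (g v) (h f3 i) = act (g w) (h f3 i)) -> g u = g v) ->
  congruent g.
Proof.
move=> n_gt0 h_gen [g_orth g_hinge] g_det g_tri u v; apply: contrapT => guv.
(* A class is represented by a canonical vertex moved by its congruence. *)
pose c x := odflt x [pick y | g y == g x].
have c_g x y : c x = c y <-> g x = g y.
  have gc z : g (c z) = g z by rewrite /c; case: pickP => //= z' /eqP.
  split=> [cxy|gxy]; first by rewrite -gc cxy gc.
  rewrite /c (eq_pick (Q := fun z => g z == g y)) => [|z]; last by rewrite gxy.
  by case: pickP => // /(_ y); rewrite eqxx.
(* Seen from body [u], that body is at rest and serves as the root of the tree. *)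
pose g' x := relative (g u) (g x).
have g'_arr : arrangement h g'.
  split=> [x|f x y xf yf i]; first exact: relative_orthogonal.
  rewrite /act /= !mulmxA -!mulmxDl !addrA.
  by have := g_hinge f x y xf yf i; rewrite /act => ->.
have g'_det : n = 1%N -> forall x y, \det ((g' y).1 *m (g' x).1^T) = 1.
  by move=> /g_det detg x y; rewrite !(det_mulmx, det_tr) !detg !mulr1.
have c_g' x y : c x = c y <-> g' x = g' y.
  rewrite c_g; split=> [|/(relative_inj (g_orth u)) //]; by rewrite /g' => ->.
have e_conn X : X != set0 -> X != setT -> exists x y, [/\ x \in X, y \notin X & e x y].
  move=> X0 XT; have : (0 < cut e X)%N.
    by apply: leq_trans (cut_ge2 e_sym e_irr delta_min delta_ge3 mu2_gt X0 XT).
  by case/card_gt0P => -[x y]; rewrite inE => /and3P[xX yX exy]; exists x, y.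
have k_gt1 : (1 < #|c @: T|)%N.
  apply/card_gt1P; exists (c u), (c v); rewrite !imset_f //; split=> //.
  by apply/eqP => /c_g.
have := crossing_bound h_gen g'_arr n_gt0 g'_det c_g' e_conn (relative_id (g_orth u)).
have [lt_m|[x [y [z [[xy yz zx] adj]]]]] :=
  crossing_large_or_triangle e_sym e_irr delta_min delta_ge3 mu2_gt k_gt1; first by lia.
have [|||f1 [u1 [v1 [u1f v1f cu1 cv1]]]] := adj x y; rewrite ?inE ?eqxx ?orbT //.
have [|||f2 [u2 [w2 [u2f w2f cu2 cw2]]]] := adj x z; rewrite ?inE ?eqxx ?orbT // 1?eq_sym //.
have [|||f3 [v3 [w3 [v3f w3f cv3 cw3]]]] := adj y z; rewrite ?inE ?eqxx ?orbT //.
(* The three hinges are distinct, since an edge with only two vertices cannot meet three classes. *)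
have three_colors (f : edge e) a1 a2 a3 : a1 \in val f -> a2 \in val f -> a3 \in val f ->
    c a1 = x -> c a2 = y -> c a3 = z -> False.
  move=> a1f a2f a3f c1 c2 c3; have := edge_colors (c := c) a1f a2f a3f.
  by rewrite c1 c2 c3 xy yz => /(_ isT isT) zxE; rewrite zxE eqxx in zx.
have g21 : g u2 = g u1 by apply/c_g; rewrite cu1.
have g31 : g v3 = g v1 by apply/c_g; rewrite cv1.
have g32 : g w3 = g w2 by apply/c_g; rewrite cw2.
move=> _; move: xy; rewrite -cu1 -cv1 => /eqP; apply; apply/c_g.
apply: (g_tri u1 v1 w2 f1 f2 f3) => [||||i|i].
- by apply/eqP => ff; apply: (three_colors f1 u1 v1 w2) => //; rewrite ff.
- by apply/eqP => ff; apply: (three_colors f1 u1 v1 w3) => //; rewrite ff.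
- by apply/eqP => ff; apply: (three_colors f2 u2 v3 w2) => //; rewrite ff.
- by move=> i; apply: g_hinge.
- by rewrite -g21; apply: g_hinge.
- by rewrite -g31 -g32; apply: g_hinge.
Qed.

Lemma generic_framework d : exists h : framework R d e, generic h.
Proof.
have [x x_indep] := ex_alg_independent R (edge e * 'I_d.-1 * 'I_d)%type.
exists (fun f i => \row_j x (f, i, j)) => p p0; apply: x_indep; rewrite -[RHS]p0.
apply: eq_bigr => m _; congr (_ * _); apply: eq_bigr => i _; congr (_ ^+ _).
by rewrite mxE; case: (enum_val i) => -[].
Qed.

Lemma spatial_globally_rigid d (h : framework R d e) : (3 <= d)%N ->
  generic h -> globally_rigid h.
Proof.
case: d h => [//|n] h; rewrite ltnS => n_gt1 h_gen g g_arr.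
apply: (arrangement_congruent (ltnW n_gt1) h_gen g_arr) => [n1|]; first by rewrite n1 in n_gt1.
move=> u v w f1 f2 f3 f12 f13 _; have [g_orth _] := g_arr.
exact: (three_hinges_spatial h_gen n_gt1 f12 f13 (g_orth u) (g_orth v) (g_orth w)).
Qed.

Lemma globally_rigid_rigid d (h : framework R d e) : globally_rigid h -> rigid h.
Proof. by move=> h_rigid; exists 1 => // g g_arr _; apply: h_rigid. Qed.

Lemma common_bound (I : finType) (P : I -> R -> Prop) :
  (forall i x y, x <= y -> P i y -> P i x) -> (forall i, exists2 x, 0 < x & P i x) ->
  exists2 x, 0 < x & forall i, P i x.
Proof.
move=> P_le P_ex; have /choice[f fP] : forall i, exists x, 0 < x /\ P i x.
  by move=> i; have [x] := P_ex i; exists x.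
exists (\big[Num.min/1]_i f i).
  by elim/big_ind: _ => // [x y x0 y0|i _]; [rewrite lt_min x0|exact: (fP i).1].
by move=> i; apply: P_le (fP i).2; exact: (@bigmin_inf _ _ _ _ i).
Qed.

(** One radius serves all triples of distinct hinges because there are finitely many, and [1 / 4]
    makes every linear part a rotation. *)
Lemma planar_rigid (h : framework R 2 e) : generic h -> rigid h.
Proof.
move=> h_gen.
pose P (f : edge e * edge e * edge e) (eps : R) :=
    f.1.1 != f.1.2 -> f.1.1 != f.2 -> f.1.2 != f.2 ->
  forall G1 G2 G3, near_identity eps G1 -> near_identity eps G2 ->
    G1.1 *m G1.1^T = 1%:M -> G2.1 *m G2.1^T = 1%:M -> G3.1 *m G3.1^T = 1%:M ->
    act G1 (h f.1.1 0) = act G2 (h f.1.1 0) -> act G1 (h f.1.2 0) = act G3 (h f.1.2 0) ->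
    act G2 (h f.2 0) = act G3 (h f.2 0) -> G1 = G2.
have near_le d eps eps' (G : 'M[R]_d * 'rV[R]_d) :
    eps <= eps' -> near_identity eps G -> near_identity eps' G.
  by move=> le_eps [nA nt]; split=> [i j|j]; apply: lt_le_trans le_eps.
have [|f|eps eps_gt0 epsP] := @common_bound _ P.
- move=> f x y xy Py f12 f13 f23 G1 G2 G3 /(near_le _ _ _ _ xy) n1 /(near_le _ _ _ _ xy) n2.
  exact: Py.
- case: f => -[f1 f2] f3.
  have [f12|f12] := eqVneq f1 f2; first by exists 1 => //; rewrite /P /= f12 eqxx.
  have [f13|f13] := eqVneq f1 f3; first by exists 1 => //; rewrite /P /= f13 eqxx.
  have [f23|f23] := eqVneq f2 f3; first by exists 1 => //; rewrite /P /= f23 eqxx.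
  have [|eps0 eps0_gt0 H] := @close_planar_triangle R (h f1 0) (h f2 0) (h f3 0).
    (* With the rows in this order, the determinant in [affine_basis_unit] is the one required by
       [close_planar_triangle]. *)
    pose a (i : 'I_2) : edge e * 'I_1 := (if i == 0 then f2 else f3, 0).
    have := affine_basis_unit h_gen (a := a) (b := (f1, 0)).
    rewrite unitmxE unitfE det_mx2 !mxE /hinge_point /a /=; apply.
      move=> i j E; have := congr1 fst E => /=.
      case: eqVneq => [->|i0]; case: eqVneq => [->|j0] //.
      + by move/eqP; rewrite (negPf f23).
      + by move/eqP; rewrite eq_sym (negPf f23).
      + by move=> _; apply: val_inj; move: i0 j0;
          case: i {E} => -[|[|]] // ?; case: j => -[|[|]].
    move=> i; apply/eqP => E; have := congr1 fst E => /=.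
    by case: ifP => _ /eqP; rewrite eq_sym ?(negPf f12) ?(negPf f13).
  by exists eps0 => // _ _ _ G1 G2 G3; apply: H.
exists (Num.min eps (1 / 4)); first by rewrite lt_min eps_gt0 /=; lra.
move=> g g_arr g_close; have [g_orth _] := g_arr.
have g_eps v : near_identity eps (g v).
  by apply: near_le (g_close v); rewrite ge_min lexx.
apply: (arrangement_congruent (n := 1) _ h_gen g_arr) => // [_ v|].
  by apply: near_identity_det (g_close v) (g_orth v); rewrite ge_min lexx orbT.
move=> u v w f1 f2 f3 f12 f13 f23 E1 E2 E3.
exact: (epsP (f1, f2, f3) f12 f13 f23 _ _ (g w)).
Qed.

End Conclusion.

Lemma min_degree_le (T : finType) (e : rel T) v : (min_degree e <= degree e v)%N.
Proof.
rewrite /min_degree; have := mem_index_enum v; elim: (index_enum T) => // w s IHs.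
rewrite inE big_cons => /predU1P[->|/IHs]; first exact: geq_minl.
exact/leq_trans/geq_minr.
Qed.

Unset Implicit Arguments.

Theorem theorem4p8 (R : realType) (T : finType) (e : rel T)
    (e_sym : symmetric e) (e_irr : irreflexive e)
    (delta : nat) (delta_min : delta = min_degree e)
    (delta_ge3 : (3 <= delta)%N) :
  (forall d : nat, (2 <= d)%N ->
     mu2 R e > (delta%:R + 1)^-1 * (2 + 1 / ('C(d.+1, 2)%:R - 1)) ->
     body_hinge_rigid R d e) /\
  (forall d : nat, (3 <= d)%N ->
     mu2 R e > (delta%:R + 1)^-1 * (2 + 2 / ('C(d.+1, 2)%:R - 1)) ->
     body_hinge_globally_rigid R d e).
Proof.
have deg v : (delta <= degree e v)%N by rewrite delta_min min_degree_le.
(* Both thresholds are at least [2 / (delta + 1)], because the added fraction is nonnegative. *)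
have mu2_gt d a : (2 <= d)%N -> 0 <= a ->
    mu2 R e > (delta%:R + 1)^-1 * (2 + a / ('C(d.+1, 2)%:R - 1)) ->
    2 < mu2 R e * delta.+1%:R.
  move=> d2 a0; have delta1 : 0 < delta%:R + 1 :> R by rewrite ltr_wpDl ?ler0n.
  rewrite -[delta.+1%:R]natr1 mulrC ltr_pdivrMr // => gt2; apply: le_lt_trans gt2.
  rewrite lerDl divr_ge0 // subr_ge0 ler1n bin_gt0; lia.
split=> d d_ge mu2_d; have [h h_gen] := generic_framework R e d.
  exists h; split=> //; have mu2_2 := mu2_gt d 1 d_ge ler01 mu2_d.
  have [d3|d_lt3] := leqP 3 d.
    exact/globally_rigid_rigid/(spatial_globally_rigid e_sym e_irr deg delta_ge3 mu2_2).
  have d2 : d = 2%N by lia.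
  by subst d; apply: (planar_rigid e_sym e_irr deg delta_ge3 mu2_2).
exists h; split=> //; have mu2_2 := mu2_gt d 2 (ltnW d_ge) (ler0n _ 2) mu2_d.
exact: (spatial_globally_rigid e_sym e_irr deg delta_ge3 mu2_2).
Qed.
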